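(* Let $F(x,y)\in\mathbb{Z}[x,y]$ be a reducible binary form of degree $n\geq 3$ with discriminant $D$. Assume that either the maximal number of pairwise non-proportional linear forms over $\mathbb{C}$ dividing $F$ is at least $3$, or $F$ is a product of powers of $2$ linear forms with rational coefficients. Let $\epsilon$ be a real number with $0<\epsilon<\frac{1}{4(n-1)}$ and let $m$ be an integer with $$0<m\leq \frac{|D|^{\frac{1}{4(n-1)}-\epsilon}}{(3.5)^{n/2}\, n^{\frac{n}{4(n-1)}}}.$$ Then the inequality $|F(x,y)|\leq m$ has at most $2n+\frac{n}{2(n-1)\epsilon}$ primitive solutions.
   Context: A pair $(x,y)\in\mathbb{Z}^2$ is a primitive solution of an inequality in $x,y$ if it satisfies it and $\gcd(x,y)=1$. Solutions $(x,y)$ and $(-x,-y)$ are regarded as one and the same solution when counting. The discriminant of $F=\prod_{i=1}^n(\alpha_i x-\beta_i y)$ is $D=\prod_{i<j}(\alpha_i\beta_j-\alpha_j\beta_i)^2$. *)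

(* Defs.v *)
From mathcomp Require Import all_boot all_order all_algebra.
From mathcomp Require Import complex mpoly.
From mathcomp Require Import classical_sets cardinality.

Set Implicit Arguments.
Unset Strict Implicit.
Unset Printing Implicit Defensive.

Import Order.TTheory GRing.Theory Num.Theory.
Local Open Scope ring_scope.

(* The variable x is 'X_0 and y is 'X_1. *)
Notation binpoly A := {mpoly A[2]}.

(* n.-homog also holds of the zero polynomial, which has no degree. *)
Definition binary_form (A : idomainType) (n : nat) (F : binpoly A) : Prop :=
  F != 0 /\ F \is n.-homog.

Definition bin_eval (A : comNzRingType) (F : binpoly A) (x y : A) : A :=
  F.@[fun i : 'I_2 => if i == ord0 then x else y].

(* Reducibility is over the rationals: an integer constant is not a proper
   factor. *)
Definition reducible (F : binpoly int) : Prop :=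
  exists G H : binpoly rat,
    [/\ (1 < msize G)%N, (1 < msize H)%N & map_mpoly intr F = G * H].

(* "F has discriminant D"; D does not depend on the choice of factorization. *)
Definition has_discriminant (R : rcfType) (n : nat) (F : binpoly int)
    (D : R[i]) : Prop :=
  exists alpha beta : 'I_n -> R[i],
    map_mpoly intr F
      = \prod_(i < n) (alpha i *: 'X_ord0 - beta i *: 'X_ord_max) :> binpoly R[i]
    /\ D = \prod_(i < n) \prod_(j < n | (i < j)%N)
             (alpha i * beta j - alpha j * beta i) ^+ 2.

Definition proportional (A : idomainType) (L M : binpoly A) : Prop :=
  exists a b : A, [/\ a != 0, b != 0 & a *: L = b *: M].

Definition divides (A : idomainType) (L F : binpoly A) : Prop :=
  exists G : binpoly A, F = L * G.

Definition nonproportional_factors (R : rcfType) (F : binpoly int) (k : nat)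
    (L : 'I_k -> binpoly R[i]) : Prop :=
  [/\ forall i, binary_form 1 (L i),
      forall i, divides (L i) (map_mpoly intr F)
    & forall i j, i != j -> ~ proportional (L i) (L j)].

Definition max_num_linear_factors (R : rcfType) (F : binpoly int) (k : nat) :
    Prop :=
  (exists L : 'I_k -> binpoly R[i], nonproportional_factors F L) /\
  (forall (l : nat) (L : 'I_l -> binpoly R[i]),
     nonproportional_factors F L -> (l <= k)%N).

(* The rational constant c is not always absorbed by the linear forms, as in
   2 x^2 y^2. *)
Definition product_of_two_rational_powers (F : binpoly int) : Prop :=
  exists (c : rat) (L M : binpoly rat) (a b : nat),
    [/\ binary_form 1 L, binary_form 1 M, ~ proportional L M,
        (0 < a)%N /\ (0 < b)%N
      & map_mpoly intr F = c *: (L ^+ a * M ^+ b)].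

Definition primitive_solution (F : binpoly int) (m : int) (p : int * int) :
    Prop :=
  gcdz p.1 p.2 = 1 /\ `|bin_eval F p.1 p.2| <= m.

(* A solution up to sign is the set {(x, y), (-x, -y)}. *)
Definition primitive_solutions_up_to_sign (F : binpoly int) (m : int) :
    set (set (int * int)) :=
  [set [set p; (- p.1, - p.2)] | p in primitive_solution F m]%classic.

Definition at_most (R : numDomainType) (T : Type) (A : set T) (B : R) : Prop :=
  exists k : nat, (A #<= `I_k)%card /\ k%:R <= B.

(* Main.v *)
(* Write F = prod L_i with L_i(x, y) = a_i x - b_i y, and measure F in a basis
   E of Z^2 by its height H = prod_i max(|L_i(E1)|, |L_i(E2)|).  Hadamard's
   inequality for a homogeneous Vandermonde matrix gives |D| <= n^n H^(2(n-1)),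
   so, with delta = 2(n-1) eps, the hypothesis on m yields
   m (7/2)^(n/2) <= H^(1/2 - delta) in every basis, besides
   m^2 2^(n(n-1)) <= |D|.  Fix a basis whose H is minimal up to a factor 2.
   Gap principle: completing a solution P with F(P) <> 0 to a basis of Z^2 and
   comparing heights shows that P is very close to some of the roots, and two
   solutions close to the same root have very different sizes.  As the product
   over the roots of the growth factors of P is at least H^(2 delta), and these
   factors multiply to at most H^2 along each root, at most n / delta solutions
   of size at most H^2 are left after removing the largest one for each root.
   Large solutions: F = G1 G2 over Z.  A solution of size > H^2 is so close to a
   root, of G1 say, that a second solution P with the same closest root has
   |G2(P)| > m, whereas G1(P) G2(P) <> 0 forces |G2(P)| <= m.  A zero Z of F at
   that root is excluded because det(Z, W) divides F(W) for every W, which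
   bounds the size of Z; so large solutions and zeros of F together number at
   most n. *)
From HB Require Import structures.
Require Import Defs.
From mathcomp Require Import classical_sets cardinality boolp reals exp.
From mathcomp Require Import all_boot all_order all_algebra.
From mathcomp Require Import fraction spectral complex.
From mathcomp Require mpoly.
From mathcomp Require Import zify ring lra.
Set Implicit Arguments.
Unset Strict Implicit.
Unset Printing Implicit Defensive.
Import Order.TTheory GRing.Theory Num.Theory.
Local Open Scope ring_scope.

Section Det2.
Variable A : comPzRingType.
Implicit Types u v w : A * A.

Definition det2 u v : A := u.1 * v.2 - u.2 * v.1.

Lemma det2C u v : det2 v u = - det2 u v.
Proof. rewrite /det2; ring. Qed.

Lemma det2_swap_eq0 u v : (det2 v u == 0) = (det2 u v == 0).
Proof. by rewrite det2C oppr_eq0. Qed.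

Lemma det2vv v : det2 v v = 0.
Proof. rewrite /det2; ring. Qed.

Fact det2_is_zmod_morphism u : zmod_morphism (det2 u).
Proof. by move=> v w; rewrite /det2 /=; ring. Qed.

HB.instance Definition _ u :=
  GRing.isZmodMorphism.Build _ _ (det2 u) (det2_is_zmod_morphism u).

End Det2.

Section IntegerLattice.
Implicit Types P Q W : int * int.

Lemma det2_decomp P Q W :
  det2 P Q = 1 -> W = P *~ det2 W Q + Q *~ det2 P W.
Proof.
move=> PQ; have smul (X : int * int) k : X *~ k = (X.1 * k, X.2 * k).
  by rewrite -!mulrzz -(raddfMz fst) -(raddfMz snd) -surjective_pairing.
rewrite !smul [LHS]surjective_pairing; congr pair => /=.
  by rewrite -[LHS]mulr1 -PQ /det2; ring.
by rewrite -[LHS]mulr1 -PQ /det2; ring.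
Qed.

Definition primitive P : Prop := gcdz P.1 P.2 = 1.

Lemma primitive_neq0 P : primitive P -> P != 0.
Proof. by apply: contra_eq_neq => ->; rewrite gcdz0. Qed.

Lemma primitive_complete P : primitive P -> exists Q, det2 P Q = 1.
Proof.
move=> primP; have [s [t Bezout]] := Bezoutz P.1 P.2.
by exists (- t, s); rewrite -primP -Bezout /det2 /=; ring.
Qed.

Lemma primitiveMz P k : primitive P -> primitive (P *~ k) -> `|k| = 1.
Proof.
move=> primP; rewrite /primitive (raddfMz fst) (raddfMz snd) !mulrzz.
by rewrite -mulz_gcdl primP mul1r.
Qed.

Lemma primitive_det2_eq0 P Q :
  primitive P -> primitive Q -> det2 P Q = 0 -> Q = P \/ Q = - P.
Proof.
move=> primP primQ PQ0; have [P' PP'] := primitive_complete primP.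
have := det2_decomp Q PP'; rewrite PQ0 mulr0z addr0.
set k := det2 Q P' => Q_def; rewrite Q_def in primQ.
have [k1|kN1] : k = 1 \/ k = -1 by have := primitiveMz primP primQ; lia.
  by left; rewrite Q_def k1 mulr1z.
by right; rewrite Q_def kN1 mulrN1z.
Qed.

Lemma divz_nearest (u v : int) :
  v != 0 -> exists k : int, 2 * `|u - k * v| <= `|v|.
Proof.
move=> v0; have r_ge0 := modz_ge0 u v0; have r_lt := ltz_mod u v0.
have := divz_eq u v; set r := (u %% v)%Z in r_ge0 r_lt *; set q := (u %/ v)%Z => uE.
have [small_r|large_r] := leP (2 * r) `|v|.
  by exists q; have -> : u - q * v = r; [rewrite uE; ring | rewrite ger0_norm].
exists (q + Num.sg v); have -> : u - (q + Num.sg v) * v = r - `|v|.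
  by rewrite normrEsg uE; ring.
rewrite ler0_norm; lia.
Qed.

End IntegerLattice.

Lemma prod_setC (A : comNzRingType) (T : finType) (S : {set T}) (f : T -> A) :
  \prod_t f t = \prod_(t in S) f t * \prod_(t in ~: S) f t.
Proof.
by rewrite (bigID (mem S)) /=; congr (_ * _); apply: eq_bigl => t; rewrite inE.
Qed.

Lemma prod_offdiagE (A : comNzRingType) n (f : 'I_n -> 'I_n -> A) :
  \prod_i \prod_(j | j != i) f i j
  = \prod_(i < n) \prod_(j < n | (i < j)%N) (f i j * f j i).
Proof.
have split_row (i : 'I_n) : \prod_(j | j != i) f i j =
    \prod_(j < n | (i < j)%N) f i j * \prod_(j < n | (j < i)%N) f i j.
  rewrite (bigID (fun j : 'I_n => (i < j)%N)) /=.
  by congr (_ * _); apply: eq_bigl => j; rewrite -val_eqE /=; case: ltngtP.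
rewrite (eq_bigr _ (fun i _ => split_row i)) big_split /=.
rewrite [X in _ * X](exchange_big_dep predT) //= -big_split /=.
by apply: eq_bigr => i _; rewrite big_split.
Qed.

Lemma prod_offdiag_sym (A : comNzRingType) n (f : 'I_n -> 'I_n -> A) :
  (forall i j, f i j = f j i) ->
  \prod_i \prod_(j | j != i) f i j
  = (\prod_(i < n) \prod_(j < n | (i < j)%N) f i j) ^+ 2.
Proof.
move=> fC; rewrite prod_offdiagE -prodrXl; apply: eq_bigr => i _.
by rewrite -prodrXl; apply: eq_bigr => j _; rewrite expr2 [in f j i]fC.
Qed.

Lemma prod_lt_mul (A : comNzRingType) n (f : 'I_n -> A) :
  \prod_(i < n) \prod_(j < n | (i < j)%N) (f i * f j) = \prod_i f i ^+ n.-1.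
Proof.
rewrite -(prod_offdiagE (fun i _ => f i)).
by apply: eq_bigr => i _; rewrite prodr_const cardC1 card_ord.
Qed.

Lemma prod_offdiag_mul (A : comNzRingType) n (f : 'I_n -> A) :
  \prod_i \prod_(j | j != i) (f i * f j) = (\prod_i f i) ^+ (n.-1).*2.
Proof.
rewrite prod_offdiag_sym => [|i j]; last exact: mulrC.
by rewrite prod_lt_mul prodrXl -exprM muln2.
Qed.

Lemma ler_prod_subset (R : numDomainType) (T : finType) (S S' : {set T}) (f : T -> R) :
  (forall t, t \in S' -> 1 <= f t) -> S \subset S' ->
  \prod_(t in S) f t <= \prod_(t in S') f t.
Proof.
move=> f_ge1 /setIidPr SS'; rewrite [leRHS](big_setID S) /= SS' ler_peMr //.
  apply: prodr_ge0 => t; rewrite -SS' inE => /andP[tS' _].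
  exact: le_trans ler01 (f_ge1 t tS').
apply: (@le_trans _ _ (\prod_(t in S' :\: S) 1)); first by rewrite big1.
by apply: ler_prod => t; rewrite inE ler01 => /andP[_ /f_ge1].
Qed.

(* Removing the largest element, the factors g x telescope along the values of
   h in increasing order. *)
Lemma prod_gap_le (R : realDomainType) (T : finType) (h g : T -> R) (S : {set T}) :
  (forall x, x \in S -> 1 <= h x) -> (forall x, x \in S -> 1 <= g x) ->
  {in S &, forall x y, x != y -> h x <= h y -> h x * g x <= h y} ->
  forall x0, x0 \in S -> exists2 e, e \in S &
    (forall x, x \in S -> h x <= h e) /\ \prod_(x in S :\ e) g x <= h e.
Proof.
have [k] := ubnP #|S|; elim: k S => // k IH S S_small h_ge1 g_ge1 gap x0 x0S.
have [e eS e_max] : exists2 e, e \in S & forall x, x \in S -> h x <= h e.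
  by case: (@Order.TotalTheory.arg_maxP _ _ _ x0 (mem S) h x0S) => e; exists e.
exists e => //; split=> //.
have [->|[y yS]] := set_0Vmem (S :\ e); first by rewrite big_set0 h_ge1.
have sub x : x \in S :\ e -> x \in S by case/setD1P.
have [||||d dS [_ prod_le]] := IH (S :\ e) _ _ _ _ y yS.
- by move: S_small; rewrite (cardsD1 e) eS.
- by move=> x /sub; apply: h_ge1.
- by move=> x /sub; apply: g_ge1.
- by move=> x z /sub xS /sub zS; apply: gap.
have dS' := sub _ dS.
rewrite (big_setD1 d) //= mulrC; apply: le_trans (gap _ _ dS' eS _ (e_max _ dS')).
  by rewrite ler_wpM2r // (le_trans ler01) ?g_ge1.
by case/setD1P: dS.
Qed.

(* Elements with g x = 1 contribute nothing, so the gap condition is only needed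
   between elements with g x > 1. *)
Lemma prod_gap_le_bound (R : realDomainType) (T : finType) (h g : T -> R)
    (S : {set T}) (B : R) :
  1 <= B -> (forall x, x \in S -> 1 <= h x <= B) -> (forall x, 1 <= g x) ->
  {in S &, forall x y, x != y -> h x <= h y -> 1 < g x -> 1 < g y ->
    h x * g x <= h y} ->
  exists2 X : {set T}, (#|X| <= 1)%N & \prod_(x in S :\: X) g x <= B.
Proof.
move=> B_ge1 h_bound g_ge1 gap; pose S' := [set x in S | 1 < g x].
have S'S : S' \subset S by apply/subsetP=> x; rewrite inE => /andP[].
have prodS' (X : {set T}) : \prod_(x in S :\: X) g x = \prod_(x in S' :\: X) g x.
  rewrite (big_setID S') /= [X in _ * X]big1 ?mulr1 => [|x].
    by apply: eq_bigl => x; rewrite !inE; case: (x \in S); rewrite ?andbF ?andbT.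
  rewrite !inE lt_def g_ge1 andbT => /andP[gx /andP[_ xS]].
  by move: gx; rewrite xS negbK => /eqP.
have [S'0|[x0 x0S']] := set_0Vmem S'.
  by exists set0; rewrite ?cards0 // prodS' S'0 set0D big_set0.
have [|||e eS' [_ e_prod]] := @prod_gap_le _ _ h g S' _ _ _ x0 x0S'.
- by move=> x /(subsetP S'S) /h_bound /andP[].
- by move=> x _.
- by move=> x y; rewrite !inE => /andP[xS gx] /andP[yS gy] *; apply: gap.
exists [set e]; rewrite ?cards1 // prodS'; apply: le_trans e_prod _.
by have /h_bound /andP[] := subsetP S'S _ eS'.
Qed.

(** * Linear forms and integral points *)

Section LinearForm.
Variable A : comPzRingType.

(* The pair l stands for the linear form l.1 x - l.2 y. *)
Definition lform (l : A * A) (P : int * int) : A := l.1 * P.1%:~R - l.2 * P.2%:~R.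

Fact lform_is_zmod_morphism l : zmod_morphism (lform l).
Proof. by move=> P Q; rewrite /lform /= !rmorphB /=; ring. Qed.

HB.instance Definition _ l :=
  GRing.isZmodMorphism.Build _ _ (lform l) (lform_is_zmod_morphism l).

Lemma lformMz l P k : lform l (P *~ k) = lform l P * k%:~R.
Proof. by rewrite raddfMz mulrzr. Qed.

Lemma lform_plucker l P Q W :
  lform l W * (det2 P Q)%:~R
  = lform l P * (det2 W Q)%:~R - lform l Q * (det2 W P)%:~R.
Proof. rewrite /lform /det2 !rmorphB !rmorphM /=; ring. Qed.

Lemma det2_lform l l' P Q :
  det2 l l' * (det2 P Q)%:~R = lform l Q * lform l' P - lform l P * lform l' Q.
Proof. rewrite /lform /det2 !rmorphB !rmorphM /=; ring. Qed.

Lemma lform_eq0_basis l P Q :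
  det2 P Q = 1 -> lform l P = 0 -> lform l Q = 0 -> l = 0.
Proof.
move=> PQ lP lQ; have l_zero W : lform l W = 0.
  by rewrite (det2_decomp W PQ) raddfD /= !lformMz lP lQ !mul0r addr0.
have := l_zero (1, 0); have := l_zero (0, 1); rewrite /lform !(mulr0, mulr1) /=.
rewrite subr0 sub0r => /eqP; rewrite oppr_eq0 => /eqP l2 l1.
by rewrite [l]surjective_pairing l1 l2.
Qed.

End LinearForm.

Record absolute_value (K : pzRingType) (R : realDomainType) := AbsoluteValue {
  absv :> K -> R;
  absv_ge0 : forall x, 0 <= absv x;
  absv0_eq0 : forall x, absv x = 0 -> x = 0;
  absvM : forall x y, absv (x * y) = absv x * absv y;
  ler_absvD : forall x y, absv (x + y) <= absv x + absv y;
  absv_int : forall z : int, absv z%:~R = `|z|%:~R }.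
Arguments absv : simpl never.

Section AbsoluteValueTheory.
Variables (K : comPzRingType) (R : realDomainType) (N : absolute_value K R).

Lemma absv0 : N 0 = 0.
Proof. by rewrite -[0 in LHS]/(0%:~R) absv_int normr0. Qed.

Lemma absv1 : N 1 = 1.
Proof. by rewrite -[1 in LHS]/(1%:~R) absv_int normr1. Qed.

Lemma absv_gt0 x : (0 < N x) = (x != 0).
Proof.
rewrite lt_def absv_ge0 andbT; congr (~~ _); apply/eqP/eqP=> [|->].
  exact: absv0_eq0.
exact: absv0.
Qed.

Lemma absvN x : N (- x) = N x.
Proof.
by rewrite -mulN1r absvM -[- 1](rmorphN1 (intmul 1)) absv_int normrN1 mul1r.
Qed.

Lemma ler_absvB x y : N (x - y) <= N x + N y.
Proof. by rewrite -(absvN y) ler_absvD. Qed.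

Lemma absv_prod (I : finType) (P : pred I) (f : I -> K) :
  N (\prod_(i | P i) f i) = \prod_(i | P i) N (f i).
Proof. exact: (big_morph N (absvM N) absv1). Qed.

Lemma absvX x k : N (x ^+ k) = N x ^+ k.
Proof. by elim: k => [|k IH]; rewrite ?expr0 ?absv1 // !exprS absvM IH. Qed.

End AbsoluteValueTheory.

Lemma ler1_norm_intr (R : realDomainType) (z : int) : z != 0 -> 1 <= `|z|%:~R :> R.
Proof. by move=> z0; rewrite -[1]/(1%:~R) ler_int -gtz0_ge1 normr_gt0. Qed.

Lemma expr_pred (A : pzSemiRingType) (x : A) k :
  (0 < k)%N -> x ^+ k = x * x ^+ k.-1.
Proof. by case: k => // k _; rewrite exprS. Qed.

Definition unimodular (E : (int * int) * (int * int)) : Prop := det2 E.1 E.2 = 1.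

Section Heights.
Variables (K : fieldType) (R : realFieldType) (N : absolute_value K R).
Variable E : (int * int) * (int * int).
Local Notation basis := [:: E.1; E.2].

Implicit Types (l : K * K) (P Q W X : int * int).

(* The sup norm of the coordinates of P in the basis E. *)
Definition supnorm P : R := Num.max `|det2 P E.1|%:~R `|det2 P E.2|%:~R.

Definition fnorm l : R := Num.max (N (lform l E.1)) (N (lform l E.2)).

(* Scale-invariant measures of how far P, respectively the root of l', is from
   the root of l. *)
Definition nval l P : R := N (lform l P) / fnorm l.

Definition chord l l' : R := N (det2 l l') / (fnorm l * fnorm l').

Lemma le_supnorm P X : X \in basis -> `|det2 P X|%:~R <= supnorm P.
Proof. by rewrite !inE => /orP[] /eqP ->; rewrite le_max lexx ?orbT. Qed.

Lemma supnorm_attained P :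
  exists2 X, X \in basis & supnorm P = `|det2 P X|%:~R.
Proof.
by rewrite /supnorm; case: leP => _; [exists E.2 | exists E.1];
  rewrite ?inE ?eqxx ?orbT.
Qed.

Lemma le_fnorm l X : X \in basis -> N (lform l X) <= fnorm l.
Proof. by rewrite !inE => /orP[] /eqP ->; rewrite le_max lexx ?orbT. Qed.

Lemma fnorm_attained l : exists2 X, X \in basis & fnorm l = N (lform l X).
Proof.
by rewrite /fnorm; case: leP => _; [exists E.2 | exists E.1];
  rewrite ?inE ?eqxx ?orbT.
Qed.

Lemma supnorm_ge0 P : 0 <= supnorm P.
Proof. by rewrite le_max ler0z normr_ge0. Qed.

Lemma fnorm_ge0 l : 0 <= fnorm l.
Proof. by rewrite le_max absv_ge0. Qed.

Lemma nval_ge0 l P : 0 <= nval l P.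
Proof. by rewrite divr_ge0 ?absv_ge0 ?fnorm_ge0. Qed.

Lemma chord_ge0 l l' : 0 <= chord l l'.
Proof. by rewrite divr_ge0 ?mulr_ge0 ?absv_ge0 ?fnorm_ge0. Qed.

Lemma chordC l l' : chord l l' = chord l' l.
Proof. by rewrite /chord det2C absvN [fnorm l * _]mulrC. Qed.

Lemma det2_fnorm_le l P Q :
  `|det2 P Q|%:~R * fnorm l <= supnorm P * N (lform l Q) + supnorm Q * N (lform l P).
Proof.
have [X EX ->] := fnorm_attained l.
rewrite -(absv_int N) mulrC -absvM lform_plucker.
apply: le_trans (ler_absvB N _ _) _; rewrite !absvM !absv_int addrC.
by apply: lerD; rewrite mulrC ler_wpM2r ?absv_ge0 // det2C normrN le_supnorm.
Qed.

Lemma det2_supnorm_le l l' P :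
  N (det2 l l') * supnorm P <= fnorm l * N (lform l' P) + fnorm l' * N (lform l P).
Proof.
have [X EX ->] := supnorm_attained P.
rewrite -(absv_int N) -absvM det2_lform; apply: le_trans (ler_absvB N _ _) _.
rewrite !absvM [N (lform l P) * _]mulrC.
by apply: lerD; rewrite ler_wpM2r ?absv_ge0 ?le_fnorm.
Qed.

Lemma zero_supnorm_le l Z W :
  lform l Z = 0 -> N (lform l W) * supnorm Z <= fnorm l * `|det2 Z W|%:~R.
Proof.
move=> lZ0; have [X EX ->] := supnorm_attained Z.
have -> : N (lform l W) * `|det2 Z X|%:~R = N (lform l X) * `|det2 Z W|%:~R.
  rewrite -!(absv_int N) -!absvM lform_plucker lZ0 mul0r sub0r absvN.
  by rewrite det2C rmorphN mulrN absvN.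
by rewrite ler_wpM2r ?ler0z ?le_fnorm.
Qed.

Hypothesis E_unimod : unimodular E.

Lemma supnorm_ge1 P : P != 0 -> 1 <= supnorm P.
Proof.
move=> P0; rewrite le_max; apply/orP.
have [PE1|] := eqVneq (det2 P E.1) 0; last by left; apply: ler1_norm_intr.
have [PE2|] := eqVneq (det2 P E.2) 0; last by right; apply: ler1_norm_intr.
case/eqP: P0; rewrite (det2_decomp P E_unimod) PE2 [det2 E.1 P]det2C PE1.
by rewrite oppr0 !mulr0z addr0.
Qed.

Lemma fnorm_gt0 l : l != 0 -> 0 < fnorm l.
Proof.
apply: contra_neqT; rewrite -leNgt ge_max => /andP[l1 l2].
have vanish x : N x <= 0 -> x = 0.
  by move=> Nx; apply/(@absv0_eq0 _ _ N)/le_anti; rewrite Nx absv_ge0.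
exact: (lform_eq0_basis E_unimod (vanish _ l1) (vanish _ l2)).
Qed.

Lemma det2_le_nval l P Q :
  l != 0 -> `|det2 P Q|%:~R <= supnorm P * nval l Q + supnorm Q * nval l P.
Proof.
move=> /fnorm_gt0 l_gt0; rewrite /nval !mulrA -mulrDl ler_pdivlMr //.
exact: det2_fnorm_le.
Qed.

Lemma det2_neq0_le_nval l P Q :
  l != 0 -> det2 P Q != 0 -> 1 <= supnorm P * nval l Q + supnorm Q * nval l P.
Proof.
by move=> l0 PQ0; apply: le_trans (det2_le_nval P Q l0); apply: ler1_norm_intr.
Qed.

Lemma chord_supnorm_le l l' P : l != 0 -> l' != 0 ->
  chord l l' * supnorm P <= nval l' P + nval l P.
Proof.
move=> /fnorm_gt0 l_gt0 /fnorm_gt0 l'_gt0.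
have -> : nval l' P + nval l P =
    (fnorm l * N (lform l' P) + fnorm l' * N (lform l P)) / (fnorm l * fnorm l').
  by rewrite /nval; field; rewrite !gt_eqF.
by rewrite /chord mulrAC ler_pM2r ?invr_gt0 ?mulr_gt0 // det2_supnorm_le.
Qed.

Lemma chord_le2 l l' : l != 0 -> l' != 0 -> chord l l' <= 2.
Proof.
move=> l0 l'0; rewrite ler_pdivrMr ?mulr_gt0 ?fnorm_gt0 //.
rewrite -[det2 l l']mulr1 -[1]/(1%:~R) -E_unimod det2_lform.
apply: le_trans (ler_absvB N _ _) _; rewrite !absvM mulr2n mulrDl mul1r.
by apply: lerD; apply: ler_pM; rewrite ?absv_ge0 ?le_fnorm ?inE ?eqxx ?orbT.
Qed.

Lemma det2_shear k : det2 (E.1 + E.2 *~ k) E.2 = 1.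
Proof.
rewrite det2C (raddfD (det2 E.2)) /= raddfMz /= det2vv mul0rz addr0 -det2C.
exact: E_unimod.
Qed.

Lemma lform_shear_inj l (k k' : int) : l != 0 ->
  lform l (E.1 + E.2 *~ k) = 0 -> lform l (E.1 + E.2 *~ k') = 0 ->
  k%:~R = k'%:~R :> K.
Proof.
move=> l0; rewrite !raddfD /= !lformMz => lk lk'.
have : lform l E.2 * (k%:~R - k'%:~R) = 0.
  by rewrite -[RHS](subrr 0) -{1}lk -lk'; ring.
move/eqP; rewrite mulf_eq0 => /orP[/eqP lE2|]; last by rewrite subr_eq0 => /eqP.
move: lk; rewrite lE2 mul0r addr0 => lE1.
by case/eqP: l0; apply: lform_eq0_basis lE1 lE2.
Qed.

Lemma lform_shear_le l (k : nat) : N (lform l (E.1 + E.2 *~ k)) <= k.+1%:R * fnorm l.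
Proof.
rewrite raddfD /= lformMz; apply: le_trans (ler_absvD _ _ _) _.
rewrite absvM absv_int addrC.
rewrite -natr1 mulrDl mul1r [N _ * _]mulrC lerD // ?ler_wpM2l ?ler0z //;
by rewrite le_fnorm ?inE ?eqxx ?orbT.
Qed.

(* P is completed to a basis P, P' of Z^2, with P' chosen modulo P so that a
   vector of E at which the norm of P is attained has a small coordinate
   along P. *)
Lemma primitive_complete_near P : primitive P -> exists2 P', det2 P P' = 1 &
  forall l, N (lform l P') * supnorm P <= fnorm l + N (lform l P) * (supnorm P / 2).
Proof.
move=> primP; have [X EX normP] := supnorm_attained P.
have PX0 : det2 P X != 0.
  apply/eqP => PX0; have := supnorm_ge1 (primitive_neq0 primP).
  by rewrite normP PX0 normr0 ler10.
have [Q PQ] := primitive_complete primP.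
have [k kP] := divz_nearest (det2 X Q) PX0.
have PP' : det2 P (Q + P *~ k) = 1.
  by rewrite raddfD /= raddfMz /= det2vv mul0rz addr0.
exists (Q + P *~ k) => // l; set P' := Q + P *~ k.
have lX : lform l X = lform l P * (det2 X Q)%:~R + lform l Q * (det2 P X)%:~R.
  have -> : lform l X = lform l X * (det2 P Q)%:~R by rewrite PQ mulr1.
  by rewrite lform_plucker (det2C P X) rmorphN; ring.
have lP' : lform l P' * (det2 P X)%:~R
    = lform l X - lform l P * (det2 X Q - k * det2 P X)%:~R.
  by rewrite /P' raddfD /= lformMz lX (rmorphB _ (det2 X Q)) rmorphM /=; ring.
rewrite normP -(absv_int N) -absvM lP'; apply: le_trans (ler_absvB N _ _) _.
rewrite lerD ?le_fnorm // absvM ler_wpM2l ?absv_ge0 // !absv_int.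
have : (2 * `|det2 X Q - k * det2 P X|)%:~R <= `|det2 P X|%:~R :> R by rewrite ler_int.
by rewrite rmorphM /=; lra.
Qed.

(* Equal to 1 unless 2 * supnorm P * nval l P < 1, and also (as 0^-1 = 0) when P
   is a zero of l. *)
Definition growth l P : R := Num.max 1 (2 * supnorm P * nval l P)^-1.

Lemma growth_ge1 l P : 1 <= growth l P.
Proof. by rewrite le_max lexx. Qed.

Lemma growth_gt1 l P : 1 < growth l P ->
  [/\ 0 < supnorm P, 0 < nval l P, 2 * supnorm P * nval l P < 1
    & supnorm P * growth l P = (2 * nval l P)^-1].
Proof.
rewrite /growth lt_max ltxx /= => inv_gt1; rewrite (max_r (ltW inv_gt1)).
have prod_gt0 : 0 < 2 * supnorm P * nval l P.
  by rewrite -invr_gt0 (lt_trans ltr01).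
have P_gt0 : 0 < supnorm P.
  by rewrite lt_def supnorm_ge0 andbT; apply: contraTneq prod_gt0 => ->;
    rewrite mulr0 mul0r ltxx.
have nval_gt0 : 0 < nval l P by rewrite pmulr_rgt0 // mulr_gt0 in prod_gt0.
split=> //; first by rewrite -invf_gt1.
by field; rewrite !gt_eqF.
Qed.

Lemma growth_gap l P Q : l != 0 -> det2 P Q != 0 -> supnorm P <= supnorm Q ->
  1 < growth l P -> 1 < growth l Q -> supnorm P * growth l P <= supnorm Q.
Proof.
move=> l0 PQ0 PQ /growth_gt1[_ lP_gt0 _ ->] /growth_gt1[_ _ lQ_lt _].
rewrite -[leLHS]mul1r ler_pdivrMr; last exact: mulr_gt0.
have := det2_neq0_le_nval l0 PQ0; have := ler_wpM2r (nval_ge0 l Q) PQ; lra.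
Qed.

Lemma primitive_complete_growth P : primitive P -> exists2 P', det2 P P' = 1 &
  forall l, l != 0 -> lform l P != 0 ->
    Num.max (N (lform l P)) (N (lform l P')) <= N (lform l P) * (5 / 2 * growth l P).
Proof.
move=> primP; have P_gt0 : 0 < supnorm P.
  exact: lt_le_trans ltr01 (supnorm_ge1 (primitive_neq0 primP)).
have [P' PP' near] := primitive_complete_near primP.
exists P' => // l /fnorm_gt0 l_gt0; rewrite -(absv_gt0 N) => lP_gt0.
have g_ge1 := growth_ge1 l P.
rewrite ge_max; apply/andP; split; first by rewrite ler_peMr ?absv_ge0 //; lra.
rewrite -(ler_pM2r P_gt0); apply: le_trans (near l) _.
have inv_le : (2 * supnorm P * nval l P)^-1 <= growth l P by rewrite le_max lexx orbT.
have -> : fnorm l = 2 * (2 * supnorm P * nval l P)^-1 * N (lform l P) * supnorm P.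
  by rewrite /nval; field; rewrite !gt_eqF.
have := mulr_gt0 lP_gt0 P_gt0; nra.
Qed.

Section Family.
Variables (n : nat) (l : 'I_n -> K * K).
Hypothesis l_neq0 : forall i, l i != 0.

Definition height : R := \prod_i fnorm (l i).

Definition absdisc : R := \prod_i \prod_(j | j != i) N (det2 (l i) (l j)).

Definition form_abs P : R := \prod_i N (lform (l i) P).

Definition closest i P : Prop := forall j, nval (l i) P <= nval (l j) P.

Local Notation H := height.

Lemma height_gt0 : 0 < H.
Proof. by apply: prodr_gt0 => i _; apply: fnorm_gt0. Qed.

Lemma absdisc_ge0 : 0 <= absdisc.
Proof. by apply: prodr_ge0 => i _; apply: prodr_ge0 => j _; apply: absv_ge0. Qed.

Lemma absv_discriminant :
  N (\prod_(i < n) \prod_(j < n | (i < j)%N)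
       ((l i).1 * (l j).2 - (l j).1 * (l i).2) ^+ 2) = absdisc.
Proof.
rewrite /absdisc prod_offdiag_sym => [|i j]; last by rewrite det2C absvN.
rewrite absv_prod -prodrXl; apply: eq_bigr => i _.
rewrite absv_prod -prodrXl; apply: eq_bigr => j _.
by rewrite absvX /det2 [(l j).1 * _]mulrC.
Qed.

Lemma prod_chord_ge0 (A : {pred 'I_n}) i : 0 <= \prod_(j in A) chord (l i) (l j).
Proof. by apply: prodr_ge0 => j _; apply: chord_ge0. Qed.

Lemma prod_chord :
  \prod_i \prod_(j | j != i) chord (l i) (l j) = absdisc / H ^+ (n.-1).*2.
Proof.
rewrite /absdisc -prod_offdiag_mul -prodfV -big_split /=; apply: eq_bigr => i _.
by rewrite -prodfV -big_split.
Qed.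

(* The chords between two roots other than i0 are at most 2. *)
Lemma prod_chord_le i0 :
  absdisc / H ^+ (n.-1).*2
  <= (\prod_(j | j != i0) chord (l i0) (l j)) ^+ 2 * (2 ^+ n.-2) ^+ n.-1.
Proof.
rewrite -prod_chord (bigD1 i0) //= expr2 -mulrA ler_wpM2l ?prod_chord_ge0 //.
have -> : (2 ^+ n.-2) ^+ n.-1 = \prod_(j | j != i0) (2 ^+ n.-2 : R).
  by rewrite prodr_const cardC1 card_ord.
rewrite -big_split /=; apply: ler_prod => i i_i0; rewrite prod_chord_ge0 /=.
rewrite (bigD1 i0) 1?eq_sym //= chordC ler_wpM2l ?chord_ge0 //.
have -> : 2 ^+ n.-2 = \prod_(j | (j != i) && (j != i0)) (2 : R).
  rewrite prodr_const; congr (_ ^+ _).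
  have := cardC1 i; rewrite card_ord => <-.
  rewrite [in LHS](cardD1 i0) !inE eq_sym i_i0 /=.
  by apply: eq_card => j; rewrite !inE andbC.
by apply: ler_prod => j _; rewrite chord_ge0 chord_le2.
Qed.

Lemma form_abs_nval i P :
  form_abs P = H * (nval (l i) P * \prod_(j | j != i) nval (l j) P).
Proof.
have -> : nval (l i) P * \prod_(j | j != i) nval (l j) P = \prod_j nval (l j) P.
  by rewrite [RHS](bigD1 i).
rewrite /form_abs -big_split /=; apply: eq_bigr => j _.
by rewrite /nval mulrC divfK // gt_eqF ?fnorm_gt0.
Qed.

Lemma form_abs_eq0 P : (form_abs P == 0) = [exists i, lform (l i) P == 0].
Proof.
apply/prodf_eq0/existsP; case=> i; last by move/eqP=> lP; exists i; rewrite ?lP ?absv0.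
by move=> _ /eqP /absv0_eq0 lP; exists i; apply/eqP.
Qed.

Lemma exists_closest P : (0 < n)%N -> exists i, closest i P.
Proof.
move=> n_gt0; pose i0 := Ordinal n_gt0.
by case: (@Order.TotalTheory.arg_minP _ _ _ i0 predT (fun i => nval (l i) P) isT)
  => i _ i_min; exists i => j; apply: i_min.
Qed.

Lemma closest_nval_ge i j P :
  closest i P -> chord (l i) (l j) * (supnorm P / 2) <= nval (l j) P.
Proof. by move/(_ j); have := chord_supnorm_le P (l_neq0 i) (l_neq0 j); lra. Qed.

Lemma closest_form_abs_eq0 i P : closest i P -> form_abs P = 0 -> lform (l i) P = 0.
Proof.
move=> i_closest /eqP; rewrite form_abs_eq0 => /existsP[j /eqP lj].
have := i_closest j; rewrite {2}/nval lj absv0 mul0r => nval_le0.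
have : nval (l i) P == 0 by rewrite eq_le nval_le0 nval_ge0.
rewrite mulf_eq0 invr_eq0 (gt_eqF (fnorm_gt0 (l_neq0 i))) orbF.
by move/eqP/absv0_eq0.
Qed.

(* Each of the n forms vanishes at no more than one of the n + 1 points. *)
Lemma exists_nonvanishing_shear :
  exists2 k : nat, (k <= n)%N & forall i, lform (l i) (E.1 + E.2 *~ k) != 0.
Proof.
suff [k /forallP no_zero] :
    exists k : 'I_n.+1, [forall i, lform (l i) (E.1 + E.2 *~ k) != 0].
  by exists k; rewrite // -ltnS ltn_ord.
apply/existsP; apply: contraT; rewrite negb_exists => /forallP all_vanish.
have /fin_all_exists[f fP] :
    forall k : 'I_n.+1, exists i, lform (l i) (E.1 + E.2 *~ k) = 0.
  move=> k; have := all_vanish k; rewrite negb_forall.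
  by case/existsP=> i /negPn /eqP; exists i.
suff /leq_card : injective f by rewrite !card_ord ltnn.
move=> k k' fkk'; have := fP k'; rewrite -fkk'.
move/(lform_shear_inj (l_neq0 _) (fP k)) => /eqP kk'; apply/val_inj/eqP.
have : N ((k : int)%:~R - (k' : int)%:~R) = 0 by rewrite (eqP kk') subrr absv0.
by rewrite -rmorphB absv_int => /eqP; rewrite intr_eq0 normr_eq0 subr_eq0.
Qed.

Lemma exists_small_nonvanishing_point :
  exists W, (forall i, N (lform (l i) W) <= n.+1%:R * fnorm (l i)) /\
    (forall i, lform (l i) W != 0).
Proof.
have [k kn no_zero] := exists_nonvanishing_shear.
exists (E.1 + E.2 *~ k); split=> // i; apply: le_trans (lform_shear_le _ _) _.
by rewrite ler_wpM2r ?fnorm_ge0 // ler_nat.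
Qed.

Variable m : R.
Hypotheses (n_gt2 : (2 < n)%N) (m_ge1 : 1 <= m).
Hypothesis height_gt : 2 * n.+1%:R < H.
Hypothesis absdisc_ge : m ^+ 2 * 2 ^+ (n * n.-1) <= absdisc.

Let m_gt0 : 0 < m.
Proof. exact: lt_le_trans m_ge1. Qed.

Let height_gt2 : 2 < H.
Proof.
apply: le_lt_trans height_gt; have : 1 <= n.+1%:R :> R by rewrite ler1n.
lra.
Qed.

Let heightX : H ^+ n = H * H ^+ n.-1.
Proof. by rewrite expr_pred // ltnW // ltnW. Qed.

Let heightXpred : H ^+ n.-1 = H * H ^+ n.-2.
Proof. by rewrite expr_pred //; case: (n) n_gt2 => [|[]]. Qed.

Lemma prod_chord_ge i :
  m * 2 ^+ n.-1 / H ^+ n.-1 <= \prod_(j | j != i) chord (l i) (l j).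
Proof.
have H_gt0 := height_gt0.
have pow2_gt0 k : 0 < (2 : R) ^+ k by apply: exprn_gt0.
rewrite -(@ler_pXn2r _ 2) ?nnegrE ?prod_chord_ge0 //; last first.
  by rewrite divr_ge0 ?exprn_ge0 ?mulr_ge0 ?exprn_ge0 ?ltW.
rewrite -(ler_pM2r (pow2_gt0 (n.-2 * n.-1)%N)).
have := prod_chord_le i; rewrite -exprM; apply: le_trans.
rewrite expr_div_n -exprM muln2 mulrAC ler_pM2r ?invr_gt0 ?exprn_gt0 //.
apply: le_trans absdisc_ge; rewrite exprMn -mulrA -exprM -exprD.
suff -> : (n.-1 * 2 + n.-2 * n.-1 = n * n.-1)%N by [].
by case: (n) n_gt2 => [|[|k]] //= _; rewrite mulnC -mulnDl.
Qed.

(* A Lewis-Mahler type estimate: every value other than the closest one is at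
   least chord * supnorm / 2, and the discriminant bounds the product of these
   chords from below. *)
Lemma closest_nval_le i P :
  closest i P -> form_abs P <= m -> nval (l i) P * supnorm P ^+ n.-1 <= H ^+ n.-2.
Proof.
move=> i_closest P_small; have H_gt0 := height_gt0.
have others_ge :
    m * (supnorm P ^+ n.-1 / H ^+ n.-1) <= \prod_(j | j != i) nval (l j) P.
  apply: (@le_trans _ _ (\prod_(j | j != i) (chord (l i) (l j) * (supnorm P / 2)))).
    rewrite big_split /= prodr_const cardC1 card_ord exprMn exprVn.
    rewrite [leRHS]mulrA ler_pdivlMr ?exprn_gt0 //.
    apply: le_trans (ler_wpM2r _ (prod_chord_ge i)); last first.
      by rewrite exprn_ge0 ?supnorm_ge0.
    lra.
  apply: ler_prod => j _; rewrite closest_nval_ge // andbT.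
  by rewrite mulr_ge0 ?chord_ge0 ?divr_ge0 ?supnorm_ge0.
have : H * (nval (l i) P * (m * (supnorm P ^+ n.-1 / H ^+ n.-1))) <= m.
  by apply: le_trans P_small; rewrite (form_abs_nval i) ler_pM2l // ler_wpM2l ?nval_ge0.
have -> : H * (nval (l i) P * (m * (supnorm P ^+ n.-1 / H ^+ n.-1))) =
    m * (nval (l i) P * supnorm P ^+ n.-1 / H ^+ n.-2).
  by rewrite heightXpred; field; rewrite ?gt_eqF ?exprn_gt0.
by rewrite -ler_pdivlMl // mulVf ?gt_eqF // ler_pdivrMr ?exprn_gt0 // mul1r.
Qed.

Lemma large_closest_nval_le i P : closest i P -> form_abs P <= m ->
  H ^+ 2 < supnorm P -> nval (l i) P * H ^+ n <= 1.
Proof.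
move=> i_closest P_small P_large; have H_gt0 := height_gt0.
have := closest_nval_le i_closest P_small; apply: contraTT; rewrite -!ltNge => nval_gt.
apply: (@lt_le_trans _ _ (nval (l i) P * (H ^+ 2) ^+ n.-1)).
  have -> : (H ^+ 2) ^+ n.-1 = H ^+ n * H ^+ n.-2.
    by rewrite -exprM -exprD; congr (_ ^+ _); lia.
  by rewrite mulrA ltr_pMl ?exprn_gt0.
by rewrite ler_wpM2l ?nval_ge0 // lerXn2r ?nnegrE ?exprn_ge0 ?supnorm_ge0 // ltW.
Qed.

Lemma large_closest_nval_supnorm_le i P : closest i P -> form_abs P <= m ->
  H ^+ 2 < supnorm P -> 2 * (nval (l i) P * supnorm P) <= 1.
Proof.
move=> iP P_small P_large; have H_gt0 := height_gt0.
have P_gt0 : 0 < supnorm P by apply: lt_trans P_large; apply: exprn_gt0.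
have double_le : 2 * H ^+ n.-2 <= supnorm P ^+ n.-2.
  apply: (@le_trans _ _ ((2 * H) ^+ n.-2)).
    rewrite exprMn ler_pM2r ?exprn_gt0 // -[leLHS]expr1.
    by apply: ler_weXn2l; [lra | lia].
  rewrite lerXn2r ?nnegrE ?mulr_ge0 ?ltW //.
  by apply: lt_trans P_large; rewrite expr2 ltr_pM2r.
have := closest_nval_le iP P_small.
have -> : supnorm P ^+ n.-1 = supnorm P * supnorm P ^+ n.-2.
  by rewrite expr_pred //; lia.
rewrite mulrA => nval_le; have Hpow_gt0 : 0 < H ^+ n.-2 by apply: exprn_gt0.
have nval_ge := ler_wpM2l (mulr_ge0 (nval_ge0 (l i) P) (ltW P_gt0)) double_le.
by rewrite -(ler_pM2r Hpow_gt0) mul1r; lra.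
Qed.

Lemma large_closest_supnorm_ge i P Q : closest i P -> closest i Q ->
  form_abs P <= m -> form_abs Q <= m -> H ^+ 2 < supnorm P ->
  supnorm P <= supnorm Q -> det2 P Q != 0 -> H ^+ n <= 2 * supnorm Q.
Proof.
move=> iP iQ P_small Q_small P_large PQ PQ0.
have nvalQ := large_closest_nval_supnorm_le iQ Q_small (lt_le_trans P_large PQ).
have nvalP := large_closest_nval_le iP P_small P_large.
have det_ge1 := det2_neq0_le_nval (l_neq0 i) PQ0.
have nvalPQ : supnorm P * nval (l i) Q <= supnorm Q * nval (l i) Q.
  by rewrite ler_wpM2r ?nval_ge0.
have nvalP_ge : 1 <= 2 * (supnorm Q * nval (l i) P) by lra.
have := ler_wpM2r (exprn_ge0 n (ltW height_gt0)) nvalP_ge.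
have := ler_wpM2l (supnorm_ge0 Q) nvalP; lra.
Qed.

Lemma closest_det2_eq0_of_zero i P Q : closest i P -> closest i Q ->
  form_abs P = 0 -> form_abs Q = 0 -> det2 P Q = 0.
Proof.
move=> iP iQ P0 Q0; have lP := closest_form_abs_eq0 iP P0.
have lQ := closest_form_abs_eq0 iQ Q0; apply/eqP; apply: contraT => PQ0.
have := det2_neq0_le_nval (l_neq0 i) PQ0.
by rewrite /nval lP lQ absv0 !mul0r !mulr0 addr0 ler10.
Qed.

Hypothesis zero_det2_le : forall i Z W, primitive Z -> lform (l i) Z = 0 ->
  form_abs W != 0 -> `|det2 Z W|%:~R <= form_abs W.

Lemma primitive_zero_supnorm_le i Z :
  primitive Z -> lform (l i) Z = 0 -> supnorm Z <= n.+1%:R ^+ n.-1 * H.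
Proof.
move=> primZ lZ; have [W [W_small W_neq0]] := exists_small_nonvanishing_point.
have W_gt0 j : 0 < N (lform (l j) W) by rewrite absv_gt0.
have FW : form_abs W != 0 by apply/prodf_neq0 => j _; rewrite gt_eqF.
have := zero_det2_le primZ lZ FW; rewrite /form_abs (bigD1 i) //= => det_le.
rewrite -(ler_pM2l (W_gt0 i)); apply: le_trans (zero_supnorm_le W lZ) _.
apply: le_trans (ler_wpM2l (fnorm_ge0 (l i)) det_le) _.
rewrite mulrCA ler_pM2l // [H](bigD1 i) //= mulrCA ler_pM2l ?fnorm_gt0 //.
have -> : n.+1%:R ^+ n.-1 = \prod_(j | j != i) (n.+1%:R : R).
  by rewrite prodr_const cardC1 card_ord.
by rewrite -big_split /=; apply: ler_prod => j _; rewrite absv_ge0 W_small.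
Qed.

Lemma zero_large_det2_eq0 i Z P : primitive Z -> closest i Z -> form_abs Z = 0 ->
  closest i P -> form_abs P <= m -> H ^+ 2 < supnorm P -> det2 Z P = 0.
Proof.
move=> primZ iZ FZ iP P_small P_large; have lZ := closest_form_abs_eq0 iZ FZ.
apply/eqP; apply: contraT => ZP0; have H_gt0 := height_gt0.
pose x := H * nval (l i) P; pose c : R := n.+1%:R ^+ n.-1; pose h := H ^+ n.-1.
have cx_ge1 : 1 <= c * x.
  have := det2_neq0_le_nval (l_neq0 i) ZP0; rewrite {2}/nval lZ absv0 mul0r mulr0 addr0.
  move/le_trans; apply; rewrite /x mulrA ler_wpM2r ?nval_ge0 //.
  exact: primitive_zero_supnorm_le primZ lZ.
have hx_le1 : h * x <= 1.
  by have := large_closest_nval_le iP P_small P_large; rewrite heightX /x /h; lra.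
have c_lt_h : c < h.
  rewrite ltrXn2r ?nnegrE ?ler0n ?ltW //; first by lia.
  by have := height_gt; have : 0 < n.+1%:R :> R by []; lra.
have c_ge0 : 0 <= c by rewrite exprn_ge0.
have x_ge0 : 0 <= x by rewrite mulr_ge0 ?nval_ge0 ?ltW.
nra.
Qed.

(* Satisfied by the absolute values of an integral form proportional to the
   product of the linear forms with index in A. *)
Definition discrete (A : {set 'I_n}) (c : R) : Prop := forall P,
  c * \prod_(i in A) N (lform (l i) P) != 0 ->
  1 <= c * \prod_(i in A) N (lform (l i) P).

Lemma discrete_fnorm_ge (A : {set 'I_n}) c :
  0 < c -> discrete A c -> 1 <= c * \prod_(i in A) (n.+1%:R * fnorm (l i)).
Proof.
move=> c_gt0 discA; have [W [W_small W_neq0]] := exists_small_nonvanishing_point.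
apply: le_trans (discA W _) _.
  by rewrite gt_eqF // mulr_gt0 // prodr_gt0 // => i _; rewrite absv_gt0.
by rewrite ler_pM2l //; apply: ler_prod => i _; rewrite absv_ge0 W_small.
Qed.

Lemma discrete_cofactor_le (A : {set 'I_n}) c P :
  0 < c -> discrete A c -> form_abs P != 0 -> form_abs P <= m ->
  c^-1 * \prod_(i in ~: A) N (lform (l i) P) <= m.
Proof.
move=> c_gt0 discA FP P_small; apply: le_trans P_small.
have FE : form_abs P = (c * \prod_(i in A) N (lform (l i) P)) *
    (c^-1 * \prod_(i in ~: A) N (lform (l i) P)).
  by rewrite mulrACA divff ?gt_eqF // mul1r -prod_setC.
rewrite FE ler_peMl ?mulr_ge0 ?invr_ge0 ?(ltW c_gt0) ?prodr_ge0 //.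
  by move=> i _; apply: absv_ge0.
by apply: discA; move: FP; rewrite FE mulf_eq0 negb_or => /andP[].
Qed.

Lemma prod_chord_setC_ge (A : {set 'I_n}) i j : i \in A -> j \notin A ->
  2 * m / H ^+ n.-1 <= \prod_(k in ~: A) chord (l i) (l k).
Proof.
move=> iA jA; have pow2_gt0 : 0 < (2 : R) ^+ n.-2 by apply: exprn_gt0.
rewrite -(ler_pM2l pow2_gt0); apply: (@le_trans _ _ (m * 2 ^+ n.-1 / H ^+ n.-1)).
  have -> : (2 : R) ^+ n.-1 = 2 * 2 ^+ n.-2 by rewrite expr_pred //; lia.
  lra.
apply: le_trans (prod_chord_ge i) _; rewrite (bigID (mem A)) /=.
have -> : \prod_(k | (k != i) && (k \notin A)) chord (l i) (l k)
    = \prod_(k in ~: A) chord (l i) (l k).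
  by apply: eq_bigl => k; rewrite !inE; case: eqP => [->|] //=; rewrite iA.
apply: ler_wpM2r; first exact: prod_chord_ge0.
apply: (@le_trans _ _ (\prod_(k | (k != i) && (k \in A)) (2 : R))).
  by apply: ler_prod => k _; rewrite chord_ge0 chord_le2.
rewrite prodr_const; apply: ler_weXn2l; first by lra.
have := cardC1 i; rewrite card_ord => <-.
have ji : j != i by apply: contraNneq jA => ->.
rewrite [X in (_ <= X.-1)%N](cardD1 j) !inE ji.
apply/subset_leq_card/subsetP => k; rewrite !inE => /andP[-> kA].
by rewrite andbT; apply: contraNneq jA => <-.
Qed.

Lemma discrete_closest_prod_le (A : {set 'I_n}) c i Q :
  0 < c -> discrete A c -> discrete (~: A) c^-1 ->
  closest i Q -> form_abs Q != 0 -> form_abs Q <= m ->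
  \prod_(k in ~: A) (chord (l i) (l k) * (supnorm Q / (2 * n.+1%:R))) <= m.
Proof.
move=> c_gt0 discA discB iQ FQ Q_small; have n1_gt0 : 0 < n.+1%:R :> R by [].
apply: le_trans (discrete_cofactor_le c_gt0 discA FQ Q_small).
have -> : c^-1 * \prod_(k in ~: A) N (lform (l k) Q) =
    (c^-1 * \prod_(k in ~: A) (n.+1%:R * fnorm (l k)))
    * \prod_(k in ~: A) (nval (l k) Q / n.+1%:R).
  rewrite -mulrA; congr (_ * _); rewrite -big_split /=; apply: eq_bigr => k _.
  by rewrite [RHS]mulrC mulrA !divfK ?gt_eqF ?fnorm_gt0.
apply: le_trans (ler_peMl _ (discrete_fnorm_ge _ discB)); rewrite ?invr_gt0 //.
  apply: ler_prod => k _.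
  rewrite mulr_ge0 ?chord_ge0 ?divr_ge0 ?supnorm_ge0 ?mulr_ge0 //=.
  by rewrite ler_pdivlMr // invfM !mulrA divfK ?gt_eqF // -mulrA closest_nval_ge.
by apply: prodr_ge0 => k _; rewrite mulr_ge0 ?nval_ge0 ?invr_ge0.
Qed.

Lemma discrete_closest_supnorm_le (A : {set 'I_n}) c i j Q :
  0 < c -> discrete A c -> discrete (~: A) c^-1 -> i \in A -> j \notin A ->
  closest i Q -> form_abs Q != 0 -> form_abs Q <= m ->
  supnorm Q <= n.+1%:R * H ^+ n.-1.
Proof.
move=> c_gt0 discA discB iA jA iQ FQ Q_small; have H_gt0 := height_gt0.
have Hpow_ge2 : 2 <= H ^+ n.-1.
  apply: le_trans (ltW height_gt2) _; rewrite -[leLHS]expr1.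
  by apply: ler_weXn2l; [have := height_gt2; lra | lia].
have := discrete_closest_prod_le c_gt0 discA discB iQ FQ Q_small.
set X := supnorm Q / _ => prod_le.
suff X_le : 2 * X <= H ^+ n.-1.
  by move: X_le; rewrite /X invfM mulrCA mulVKf ?pnatr_eq0 // ler_pdivrMr 1?mulrC.
have [X_lt1|X_ge1] := ltP X 1; first by lra.
have X_ge0 : 0 <= X by lra.
have XP_le : X * \prod_(k in ~: A) chord (l i) (l k) <= m.
  apply: le_trans prod_le.
  rewrite [leRHS]big_split /= mulrC ler_wpM2l ?prod_chord_ge0 //.
  rewrite prodr_const -[leLHS]expr1; apply: ler_weXn2l => //.
  by apply/card_gt0P; exists j; rewrite inE.
have := le_trans (ler_wpM2l X_ge0 (prod_chord_setC_ge iA jA)) XP_le.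
have -> : X * (2 * m / H ^+ n.-1) = m * (2 * X / H ^+ n.-1) by ring.
by rewrite -[leRHS]mulr1 ler_pM2l // ler_pdivrMr ?exprn_gt0 // mul1r.
Qed.

Lemma discrete_large_det2_eq0 (A : {set 'I_n}) c i j P Q :
  0 < c -> discrete A c -> discrete (~: A) c^-1 -> i \in A -> j \notin A ->
  closest i P -> closest i Q -> form_abs P <= m -> form_abs Q <= m ->
  form_abs Q != 0 -> H ^+ 2 < supnorm P -> supnorm P <= supnorm Q -> det2 P Q = 0.
Proof.
move=> c_gt0 discA discB iA jA iP iQ P_small Q_small FQ P_large PQ.
apply/eqP; apply: contraT => PQ0; have H_gt0 := height_gt0.
have := large_closest_supnorm_ge iP iQ P_small Q_small P_large PQ PQ0.
have := discrete_closest_supnorm_le c_gt0 discA discB iA jA iQ FQ Q_small.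
have : 2 * n.+1%:R * H ^+ n.-1 < H ^+ n by rewrite heightX ltr_pM2r ?exprn_gt0.
lra.
Qed.

Variables (A : {set 'I_n}) (c : R).
Hypotheses (c_gt0 : 0 < c) (discA : discrete A c) (discB : discrete (~: A) c^-1).
Hypotheses (A_neq0 : A != set0) (AC_neq0 : ~: A != set0).

Lemma closest_large_det2_eq0 i P Q :
  closest i P -> closest i Q -> form_abs P <= m -> form_abs Q <= m ->
  form_abs Q != 0 -> H ^+ 2 < supnorm P -> supnorm P <= supnorm Q -> det2 P Q = 0.
Proof.
have [iA|iA] := boolP (i \in A).
  have [j /[!inE] jA] := set0Pn _ AC_neq0.
  exact: discrete_large_det2_eq0 c_gt0 discA discB iA jA.
have [j jA] := set0Pn _ A_neq0.
apply: (@discrete_large_det2_eq0 (~: A) c^-1 i j);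
  by rewrite ?invr_gt0 ?invrK ?setCK // inE ?negbK.
Qed.

Definition exceptional P := (form_abs P == 0) || (H ^+ 2 < supnorm P).

Lemma exceptional_det2_eq0 i P Q : primitive P -> primitive Q ->
  form_abs P <= m -> form_abs Q <= m -> closest i P -> closest i Q ->
  exceptional P -> exceptional Q -> det2 P Q = 0.
Proof.
move=> primP primQ P_small Q_small iP iQ; rewrite /exceptional.
have swap : det2 Q P = 0 -> det2 P Q = 0 by move/eqP; rewrite det2_swap_eq0 => /eqP.
have [FP|FP] := eqVneq (form_abs P) 0; have [FQ|FQ] := eqVneq (form_abs Q) 0;
  move=> /= P_exc Q_exc.
- exact: closest_det2_eq0_of_zero iP iQ FP FQ.
- exact: zero_large_det2_eq0 primP iP FP iQ Q_small Q_exc.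
- exact/swap/(zero_large_det2_eq0 primQ iQ FQ iP P_small P_exc).
have [PQ|/ltW QP] := leP (supnorm P) (supnorm Q).
  exact: closest_large_det2_eq0 iP iQ P_small Q_small FQ P_exc PQ.
exact/swap/(closest_large_det2_eq0 iQ iP Q_small P_small FP Q_exc QP).
Qed.

Hypothesis height_min : forall P P', det2 P P' = 1 ->
  H <= 2 * \prod_i Num.max (N (lform (l i) P)) (N (lform (l i) P')).

Lemma height_le_prod_growth P :
  primitive P -> form_abs P != 0 -> form_abs P <= m ->
  H <= 2 * m * (5 / 2) ^+ n * \prod_i growth (l i) P.
Proof.
move=> primP FP P_small; have [P' PP' max_le] := primitive_complete_growth primP.
apply: le_trans (height_min PP') _; rewrite -!mulrA ler_pM2l //.
apply: (@le_trans _ _ (\prod_i (N (lform (l i) P) * (5 / 2 * growth (l i) P)))).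
  apply: ler_prod => i _; rewrite le_max absv_ge0 max_le //=.
  apply: contraNneq FP => lP; rewrite form_abs_eq0.
  by apply/existsP; exists i; apply/eqP.
rewrite big_split /= ler_pM ?prodr_ge0 //.
- by move=> i _; apply: absv_ge0.
- by move=> i _; rewrite mulr_ge0 // ?(le_trans ler01) ?growth_ge1 //; lra.
by rewrite big_split /= prodr_const card_ord.
Qed.

Variables (k : nat) (p : 'I_k -> int * int).
Hypothesis p_primitive : forall t, primitive (p t).
Hypothesis p_small : forall t, form_abs (p t) <= m.
Hypothesis p_det2_neq0 : forall s t, s != t -> det2 (p s) (p t) != 0.

Lemma card_exceptional_le : (#|[set t | exceptional (p t)]| <= n)%N.
Proof.
have /fin_all_exists[f f_closest] : forall t, exists i, closest i (p t).
  by move=> t; apply: exists_closest; lia.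
rewrite -[leqRHS]card_ord -(@card_in_imset _ _ f) ?max_card // => s t.
rewrite !inE => s_exc t_exc fst; apply/eqP; apply: contraT => /p_det2_neq0 /eqP[].
by apply: (@exceptional_det2_eq0 (f t)); rewrite // -fst.
Qed.

Lemma exists_growth_bounded_subset : exists S : {set 'I_k},
  [/\ (k <= n + n + #|S|)%N, forall t, t \in S -> ~~ exceptional (p t)
    & \prod_(t in S) \prod_i growth (l i) (p t) <= (H ^+ 2) ^+ n].
Proof.
pose B := [set t | ~~ exceptional (p t)].
have H_ge1 : 1 <= H ^+ 2 by rewrite exprn_ege1 //; have := height_gt2; lra.
have /fin_all_exists2[X X_card X_prod] i : exists2 X : {set 'I_k}, (#|X| <= 1)%N &
    \prod_(t in B :\: X) growth (l i) (p t) <= H ^+ 2.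
  apply: (@prod_gap_le_bound _ _ (fun t => supnorm (p t))) => [||t|s t _ _ st st_le] //.
  - move=> t; rewrite inE negb_or -leNgt => /andP[_ ->]; rewrite andbT.
    exact: supnorm_ge1 (primitive_neq0 (p_primitive t)).
  - exact: growth_ge1.
  exact: growth_gap (l_neq0 i) (p_det2_neq0 st) st_le.
pose S := B :\: \bigcup_i X i; exists S; split=> [|t|].
- have cardX : (#|\bigcup_i X i| <= n)%N.
    apply: (@leq_trans (\sum_(i < n) 1)); last by rewrite sum1_card card_ord.
    elim/big_rec2: _ => [|i x Y _ IH]; first by rewrite cards0.
    by apply: leq_trans (leq_card_setU _ _) _; apply: leq_add.
  have := cardsC [set t | exceptional (p t)]; rewrite card_ord => k_eq.
  rewrite -[leqLHS]k_eq -addnA leq_add ?card_exceptional_le //.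
  have -> : ~: [set t | exceptional (p t)] = B by apply/setP=> t; rewrite !inE.
  rewrite -(cardsID (\bigcup_i X i) B) leq_add //.
  exact: leq_trans (subset_leq_card (subsetIr _ _)) cardX.
- by rewrite !inE => /andP[].
rewrite exchange_big /= -[X in _ <= _ ^+ X]card_ord -prodr_const.
apply: ler_prod => i _; rewrite prodr_ge0 /=; last first.
  by move=> t _; rewrite (le_trans ler01) ?growth_ge1.
apply: le_trans (X_prod i); apply: ler_prod_subset => [t _|].
  exact: growth_ge1.
by rewrite setDS // (bigcup_sup i).
Qed.

Lemma card_points_le : exists s : nat, (k <= n + n + s)%N /\
  (H / (2 * m * (5 / 2) ^+ n)) ^+ s <= (H ^+ 2) ^+ n.
Proof.
have [S [kS S_moderate S_prod]] := exists_growth_bounded_subset.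
exists #|S|; split=> //; apply: le_trans S_prod; rewrite -prodr_const.
have const_gt0 : 0 < 2 * m * (5 / 2) ^+ n by rewrite !mulr_gt0 ?exprn_gt0 //; lra.
apply: ler_prod => t /S_moderate; rewrite negb_or => /andP[Ft _].
rewrite divr_ge0 ?(ltW const_gt0) ?(ltW height_gt0) //= ler_pdivrMr // mulrC.
exact: height_le_prod_growth.
Qed.

End Family.
End Heights.

(** * The discriminant is bounded by the height *)

Section Hadamard.
Local Open Scope sesquilinear_scope.
Variable C : numClosedFieldType.

Lemma sqr_norm_det_unitary n (U : 'M[C]_n) : U \is unitarymx -> `|\det U| ^+ 2 = 1.
Proof.
move=> /unitarymxP UU1.
by rewrite normCK -[X in _ * X^*]det_tr -det_map_mx -det_mulmx UU1 det1.
Qed.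

Lemma sum_sqr_norm_row m n (A : 'M[C]_(m, n)) i :
  \sum_j `|A i j| ^+ 2 = (A *m A ^t*) i i.
Proof. by rewrite mxE; apply: eq_bigr => j _; rewrite normCK !mxE. Qed.

Lemma mul_schmidt_trig n (A : 'M[C]_n) : is_trig_mx (A *m (schmidt A) ^t*).
Proof.
have SS1 : schmidt A *m (schmidt A) ^t* = 1%:M by apply/unitarymxP/schmidt_unitarymx.
apply/is_trig_mxP => i j ij.
have : (row i A <= kermx (col j ((schmidt A) ^t*)))%MS.
  apply: submx_trans (row_schmidt_sub A i) _; apply/sumsmx_subP => k ki.
  rewrite genmxE; apply/sub_kermxP/rowP => q.
  have := congr1 (fun M : 'M_n => M k j) SS1; rewrite !mxE ord1 => entry.
  under eq_bigr do rewrite mxE [X in _ * X]mxE; rewrite entry.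
  by case: eqP ki ij => // -> j_le_i /(leq_ltn_trans j_le_i); rewrite ltnn.
move/sub_kermxP => /rowP /(_ 0); rewrite !mxE => entry0; rewrite -[RHS]entry0.
by apply: eq_bigr => k _; rewrite !mxE.
Qed.

Lemma hadamard n (A : 'M[C]_n) : `|\det A| ^+ 2 <= \prod_i \sum_j `|A i j| ^+ 2.
Proof.
have U : schmidt A \is unitarymx by apply: schmidt_unitarymx.
have SS1 := mulmx1C (unitarymxP U); pose B := A *m (schmidt A) ^t*.
have BS : B *m schmidt A = A by rewrite /B -mulmxA SS1 mulmx1.
have AA_BB : A *m A ^t* = B *m B ^t*.
  by rewrite /B trmx_mul map_mxM map_trmx trmxK map_mxCK mulmxA BS.
rewrite -{1}BS det_mulmx normrM exprMn (sqr_norm_det_unitary U) mulr1.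
rewrite (det_trig (mul_schmidt_trig A)) normr_prod -prodrXl.
apply: ler_prod => i _; rewrite exprn_ge0 //= sum_sqr_norm_row AA_BB -sum_sqr_norm_row.
by rewrite (bigD1 i) //= lerDl sumr_ge0 // => j _; rewrite exprn_ge0.
Qed.

End Hadamard.

Definition homog_vandermonde (A : pzRingType) n (l : 'I_n -> A * A) : 'M[A]_n :=
  \matrix_(i, j) ((l i).1 ^+ j * (l i).2 ^+ (n.-1 - j)).

Lemma det_homog_vandermonde_field (K : fieldType) n (l : 'I_n -> K * K) :
  (forall i, (l i).2 != 0) ->
  \det (homog_vandermonde l) = \prod_(i < n) \prod_(j < n | (i < j)%N) det2 (l j) (l i).
Proof.
move=> l2_neq0; pose v : 'rV[K]_n := \row_i ((l i).1 / (l i).2).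
have -> : homog_vandermonde l =
    diag_mx (\row_i ((l i).2 ^+ n.-1)) *m (Vandermonde n v)^T.
  apply/matrixP => i j; rewrite mul_diag_mx !mxE expr_div_n.
  have j_le : (j <= n.-1)%N by have := ltn_ord j; lia.
  by rewrite -{2}(subnK j_le) exprD; field; exact: expf_neq0.
rewrite det_mulmx det_tr det_diag det_Vandermonde.
under eq_bigr do rewrite mxE.
rewrite -prod_lt_mul -big_split /=; apply: eq_bigr => i _.
rewrite -big_split /=; apply: eq_bigr => j _.
by rewrite !mxE /det2; field; rewrite !l2_neq0.
Qed.

(* Adding an indeterminate to every (l i).2 makes them all invertible in the
   field of rational functions; the identity is then evaluated at 0. *)
Lemma det_homog_vandermonde (A : idomainType) n (l : 'I_n -> A * A) :
  \det (homog_vandermonde l) = \prod_(i < n) \prod_(j < n | (i < j)%N) det2 (l j) (l i).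
Proof.
pose lX i : {poly A} * {poly A} := ((l i).1%:P, 'X + (l i).2%:P).
pose lF i : {fraction {poly A}} * {fraction {poly A}} :=
  (tofrac (lX i).1, tofrac (lX i).2).
have det_lF : \det (homog_vandermonde lF)
    = \prod_(i < n) \prod_(j < n | (i < j)%N) det2 (lF j) (lF i).
  by apply: det_homog_vandermonde_field => i; rewrite tofrac_eq0 monic_neq0 ?monicXaddC.
have det_lX : \det (homog_vandermonde lX)
    = \prod_(i < n) \prod_(j < n | (i < j)%N) det2 (lX j) (lX i).
  apply/eqP; rewrite -tofrac_eq -det_map_mx; apply/eqP.
  have -> : map_mx (@tofrac _) (homog_vandermonde lX) = homog_vandermonde lF.
    by apply/matrixP => i j; rewrite !mxE rmorphM !rmorphXn.
  rewrite det_lF rmorph_prod; apply: eq_bigr => i _.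
  by rewrite rmorph_prod; apply: eq_bigr => j _; rewrite /det2 rmorphB !rmorphM.
have := congr1 (horner_eval 0) det_lX; rewrite -det_map_mx.
have -> : map_mx (horner_eval 0) (homog_vandermonde lX) = homog_vandermonde l.
  by apply/matrixP => i j; rewrite !mxE /horner_eval /= !hornerE.
move=> ->; rewrite rmorph_prod; apply: eq_bigr => i _.
by rewrite rmorph_prod; apply: eq_bigr => j _; rewrite /det2 /= /horner_eval !hornerE.
Qed.

Fact normc_ge0 (R : rcfType) (z : R[i]) : 0 <= ComplexField.Normc.normc z.
Proof. by case: z => x y; apply: sqrtr_ge0. Qed.

Fact normc_int (R : rcfType) (z : int) :
  ComplexField.Normc.normc (z%:~R : R[i]) = `|z|%:~R.
Proof.
have -> : (z%:~R : R[i]) = (z%:~R)%:C%C by rewrite rmorph_int.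
by rewrite /= expr0n addr0 sqrtr_sqr intr_norm.
Qed.

Definition normc_absv (R : rcfType) : absolute_value R[i] R :=
  AbsoluteValue (@normc_ge0 R) (@ComplexField.Normc.eq0_normc R)
    (@ComplexField.Normc.normcM R) (@le_normcD R) (@normc_int R).
Section DiscriminantBound.
Variable R : rcfType.
Local Notation N := (normc_absv R).

Lemma normc_hadamard n (A : 'M[R[i]]_n) :
  N (\det A) ^+ 2 <= \prod_i \sum_j N (A i j) ^+ 2.
Proof.
rewrite -lecR rmorphXn rmorph_prod /=.
under eq_bigr => i _ do rewrite rmorph_sum (eq_bigr _ (fun j _ => rmorphXn _ _ _)).
exact: hadamard.
Qed.

Lemma homog_vandermonde_row_le n (l : 'I_n -> R[i] * R[i]) i :
  \sum_j N (homog_vandermonde l i j) ^+ 2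
  <= n%:R * Num.max (N (l i).1) (N (l i).2) ^+ (n.-1).*2.
Proof.
set s := Num.max _ _; have s_ge0 : 0 <= s by rewrite le_max absv_ge0.
apply: (@le_trans _ _ (\sum_(j < n) s ^+ (n.-1).*2)); last first.
  by rewrite sumr_const card_ord mulr_natl.
apply: ler_sum => j _; rewrite mxE absvM !absvX -muln2 exprM.
have j_le : (j <= n.-1)%N by have := ltn_ord j; lia.
rewrite lerXn2r ?nnegrE ?mulr_ge0 ?exprn_ge0 ?absv_ge0 //.
rewrite -{2}(subnK j_le) addnC exprD ler_pM ?exprn_ge0 ?absv_ge0 //;
by rewrite lerXn2r ?nnegrE ?absv_ge0 // le_max lexx ?orbT.
Qed.

Lemma absdisc_homog_vandermonde n (l : 'I_n -> R[i] * R[i]) :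
  absdisc N l = N (\det (homog_vandermonde l)) ^+ 2.
Proof.
rewrite /absdisc prod_offdiag_sym => [|i j]; last by rewrite det2C absvN.
rewrite det_homog_vandermonde absv_prod; congr (_ ^+ 2).
apply: eq_bigr => i _; rewrite absv_prod.
by apply: eq_bigr => j _; rewrite det2C absvN.
Qed.

Lemma absdisc_le_height n (l : 'I_n -> R[i] * R[i]) E : unimodular E ->
  absdisc N l <= n%:R ^+ n * height N E l ^+ (n.-1).*2.
Proof.
move=> E_unimod; pose lE i := (lform (l i) E.2, lform (l i) E.1).
have -> : absdisc N l = absdisc N lE.
  apply: eq_bigr => i _; apply: eq_bigr => j _; congr (N _).
  rewrite -[LHS]mulr1 -[1]/(1%:~R) -E_unimod det2_lform /det2 /=; ring.
rewrite absdisc_homog_vandermonde; apply: le_trans (normc_hadamard _) _.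
rewrite -prodrXl -[X in _ ^+ X](card_ord n) -prodr_const -big_split /=.
apply: ler_prod => i _; rewrite sumr_ge0 /= => [|j _]; last by rewrite sqr_ge0.
by rewrite /fnorm maxC; apply: homog_vandermonde_row_le.
Qed.

End DiscriminantBound.

(** * Integral binary forms *)

Lemma rat_factor_int (f : {poly int}) (g h : {poly rat}) :
  f != 0 -> map_poly intr f = g * h ->
  exists g' h' : {poly int}, [/\ f = g' * h', size g' = size g & size h' = size h].
Proof.
move=> f0 fE.
have size_intr (q : {poly int}) : size (map_poly intr q : {poly rat}) = size q.
  by apply: size_map_inj_poly; [exact: intr_inj | rewrite rmorph0].
have /dvdpP_rat_int[g' [r r0 gE] [h' fE']] : g %| map_poly intr f.
  by rewrite fE dvdp_mulr.
have size_g : size g' = size g by rewrite gE size_scale // size_intr.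
exists g', h'; split=> //.
have [g'0 h'0] : g' != 0 /\ h' != 0 by apply/andP; rewrite -negb_or -mulf_eq0 -fE'.
have [g0 h0] : g != 0 /\ h != 0.
  by apply/andP; rewrite -negb_or -mulf_eq0 -fE -size_poly_eq0 size_intr size_poly_eq0.
have := size_mul g'0 h'0; have := size_mul g0 h0; rewrite -fE size_intr fE' => ->.
have : (0 < size g')%N by rewrite lt0n size_poly_eq0.
by rewrite size_g; move: (size g) (size h) (size h'); lia.
Qed.

Lemma prod_XsubC_factor (K : fieldType) (I : finType) (th : I -> K) (g h : {poly K}) c :
  c != 0 -> g * h = c *: \prod_i ('X - (th i)%:P) ->
  exists (A : {set I}) (d : K), [/\ d != 0, g = d *: \prod_(i in A) ('X - (th i)%:P)
    & h = (c / d) *: \prod_(i in ~: A) ('X - (th i)%:P)].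
Proof.
move=> c0 gh; have [bits] :
    {m | g %= \prod_(i <- mask m (index_enum I)) ('X - (th i)%:P)}.
  by apply: dvdp_prod_XsubC; rewrite -(dvdpZr _ _ c0) -gh dvdp_mulr.
pose A := [set i in mask bits (index_enum I)].
have -> : \prod_(i <- mask bits (index_enum I)) ('X - (th i)%:P)
    = \prod_(i in A) ('X - (th i)%:P).
  rewrite big_uniq ?mask_uniq ?index_enum_uniq //=.
  by apply: eq_bigl => i; rewrite inE.
case/eqpP=> -[x y] /= /andP[x0 y0] /(congr1 (GRing.scale x^-1)).
rewrite !scalerA mulVf // scale1r => gE.
have d0 : x^-1 * y != 0 by rewrite mulf_neq0 ?invr_eq0.
exists A, (x^-1 * y); split=> //.
have PA0 : \prod_(i in A) ('X - (th i)%:P) != 0 by apply/monic_neq0/monic_prod_XsubC.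
apply: (mulfI PA0); apply: (scalerI d0); rewrite scalerAl -gE gh (prod_setC A).
by rewrite -scalerAr scalerA mulrCA divff // mulr1.
Qed.

Lemma homogenize_prod (K : numFieldType) (I : finType) (A : {set I}) (th : I -> K)
    (d : K) (f : {poly int}) (u v : int) :
  map_poly intr f = d *: \prod_(i in A) ('X - (th i)%:P) ->
  exists z : int, z%:~R = d * \prod_(i in A) (u%:~R - th i * v%:~R).
Proof.
set q := map_poly intr f => qE; set k := #|A|.
pose PA := \prod_(i in A) ('X - (th i)%:P).
have size_PA : size PA = k.+1 by rewrite /PA -big_enum size_prod_XsubC -cardE.
have size_q : (size q <= k.+1)%N by rewrite qE -size_PA size_scale_leq.
exists (\sum_(j < k.+1) f`_j * u ^+ j * v ^+ (k - j)).
have -> : (\sum_(j < k.+1) f`_j * u ^+ j * v ^+ (k - j))%:~R =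
    \sum_(j < k.+1) q`_j * u%:~R ^+ j * v%:~R ^+ (k - j) :> K.
  rewrite rmorph_sum; apply: eq_bigr => j _.
  by rewrite !rmorphM !rmorphXn /= /q coef_map.
have [->|v0] := eqVneq v 0.
  rewrite big_ord_recr /= subnn expr0 mulr1 big1 ?add0r; last first.
    by move=> j _; rewrite /= mulr0z expr0n subn_eq0 leqNgt ltn_ord mulr0.
  have -> : q`_k = d.
    have : PA \is monic by apply: monic_prod_XsubC.
    by rewrite qE coefZ monicE /lead_coef size_PA => /eqP ->; rewrite mulr1.
  congr (_ * _); rewrite -prodr_const; apply: eq_bigr => i _.
  by rewrite mulr0z mulr0 subr0.
have v0' : v%:~R != 0 :> K by rewrite intr_eq0.
transitivity (v%:~R ^+ k * q.[u%:~R / v%:~R]).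
  rewrite (horner_coef_wide _ size_q) mulr_sumr; apply: eq_bigr => j _.
  have j_le : (j <= k)%N by rewrite -ltnS.
  have -> : v%:~R ^+ k = v%:~R ^+ (k - j) * v%:~R ^+ j :> K by rewrite -exprD subnK.
  by rewrite expr_div_n; field; exact: expf_neq0.
rewrite qE hornerZ horner_prod mulrCA -prodr_const -big_split /=; congr (_ * _).
by apply: eq_bigr => i _; rewrite hornerXsubC; field.
Qed.

Section BinaryForms.
Import mpoly.

Lemma rmorph_mmap k (A S S' : comNzRingType) (f : {rmorphism A -> S})
    (g : {rmorphism S -> S'}) (h : 'I_k -> S) (p : {mpoly A[k]}) :
  g (mmap f h p) = mmap (g \o f) (g \o h) p.
Proof.
rewrite /mmap rmorph_sum; apply: eq_bigr => m _; rewrite rmorphM /=; congr (_ * _).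
by rewrite /mmap1 rmorph_prod; apply: eq_bigr => i _; rewrite rmorphXn.
Qed.

Lemma mmap_map_mpoly k (A B S : comNzRingType) (f : {rmorphism A -> B})
    (g : {rmorphism B -> S}) (h : 'I_k -> S) (p : {mpoly A[k]}) :
  mmap g h (map_mpoly f p) = mmap (g \o f) h p.
Proof.
pose w := maxn (msize p) (msize (map_mpoly f p)).
rewrite (mmapE w) ?leq_maxr // (mmapE w) ?leq_maxl //.
by apply: eq_bigr => m _; rewrite mcoeff_map_mpoly.
Qed.

Lemma eq_mmap k (A S : comNzRingType) (f f' : A -> S) (h h' : 'I_k -> S)
    (p : {mpoly A[k]}) : f =1 f' -> h =1 h' -> mmap f h p = mmap f' h' p.
Proof.
move=> ff' hh'; apply: eq_bigr => m _; rewrite ff'; congr (_ * _).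
by apply: eq_bigr => i _; rewrite hh'.
Qed.

Lemma size_mmap_polyC (A : comNzRingType) k (h : 'I_k -> {poly A}) (p : {mpoly A[k]}) :
  (forall i, (size (h i) <= 2)%N) -> (size (mmap polyC h p) <= msize p)%N.
Proof.
move=> size_h; rewrite /mmap big_seq; apply: leq_trans (size_sum _ _ _) _.
apply/bigmax_leqP_seq => m _ mp; apply: leq_trans (msize_mdeg_lt mp).
rewrite mul_polyC; apply: leq_trans (size_scale_leq _ _) _.
rewrite /mmap1 mdegE; elim/big_rec2: _ => [|i d q _ IH]; first by rewrite size_poly1.
have size_hX : (size (h i ^+ m i) <= (m i).+1)%N.
  apply: leq_trans (size_poly_exp_leq _ _) _.
  by rewrite ltnS -[leqRHS]mul1n leq_mul2r; have := size_h i; lia.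
apply: leq_trans (size_polyMleq _ _) _; rewrite -subn1 leq_subLR add1n.
by rewrite (leq_trans (leq_add size_hX IH)) // addSn addnS.
Qed.

Definition line_poly (A : comNzRingType) (F : binpoly A) (P Q : A * A) : {poly A} :=
  mmap polyC (fun i : 'I_2 => if i == ord0 then P.1%:P + Q.1 *: 'X
                              else P.2%:P + Q.2 *: 'X) F.

Lemma horner_line_poly (A : comNzRingType) (F : binpoly A) P Q x :
  (line_poly F P Q).[x] = bin_eval F (P.1 + Q.1 * x) (P.2 + Q.2 * x).
Proof.
rewrite -horner_evalE rmorph_mmap; apply: eq_mmap => [c|i] /=.
  by rewrite /horner_eval hornerC.
by rewrite /horner_eval; case: ifP => _; rewrite !hornerE.
Qed.

Lemma map_line_poly (A B : comNzRingType) (f : {rmorphism A -> B}) (F : binpoly A) P Q :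
  map_poly f (line_poly F P Q)
  = line_poly (map_mpoly f F) (f P.1, f P.2) (f Q.1, f Q.2).
Proof.
rewrite rmorph_mmap /line_poly mmap_map_mpoly; apply: eq_mmap => [c|i] /=.
  by rewrite map_polyC.
by case: ifP => _; rewrite rmorphD /= map_polyC map_polyZ map_polyX.
Qed.

Lemma size_line_poly (A : comNzRingType) (F : binpoly A) P Q :
  (size (line_poly F P Q) <= msize F)%N.
Proof.
have size_line (x y : A) : (size (x%:P + y *: 'X)%R <= 2)%N.
  rewrite (leq_trans (size_polyD _ _)) // geq_max (leq_trans (size_polyC_leq1 _)) //.
  by rewrite (leq_trans (size_scale_leq _ _)) ?size_polyX.
by apply: size_mmap_polyC => i; case: ifP.
Qed.

Lemma line_poly_prod (A : comNzRingType) n (l : 'I_n -> A * A) P Q :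
  line_poly (\prod_(i < n) ((l i).1 *: 'X_ord0 - (l i).2 *: 'X_ord_max)) P Q
  = \prod_(i < n) (((l i).1 * P.1 - (l i).2 * P.2)%:P
                   + ((l i).1 * Q.1 - (l i).2 * Q.2) *: 'X).
Proof.
rewrite /line_poly rmorph_prod; apply: eq_bigr => i _.
rewrite rmorphB /= !mmapZ !mmapX !mmap1U /= -!mul_polyC !polyCB !polyCM; ring.
Qed.

(* On a line where F keeps its degree n, so do both factors of F, and Gauss's
   lemma makes them integral. *)
Lemma line_poly_reducible (F : binpoly int) n P Q :
  F \is n.-homog -> reducible F -> size (line_poly F P Q) = n.+1 ->
  exists g h : {poly int},
    [/\ line_poly F P Q = g * h, (1 < size g)%N & (1 < size h)%N].
Proof.
move=> F_homog [G [H [size_G size_H FGH]]] size_p.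
have G0 : G != 0 by apply: contraTneq size_G => ->; rewrite msize0.
have H0 : H != 0 by apply: contraTneq size_H => ->; rewrite msize0.
have p0 : line_poly F P Q != 0 by rewrite -size_poly_eq0 size_p.
have intr_injQ : injective (intr : int -> rat) by apply: intr_inj.
set P' : rat * rat := (P.1%:~R, P.2%:~R); set Q' : rat * rat := (Q.1%:~R, Q.2%:~R).
have pE : map_poly intr (line_poly F P Q) = line_poly G P' Q' * line_poly H P' Q'.
  by rewrite map_line_poly FGH /line_poly rmorphM.
have [g [h [pgh size_g size_h]]] := rat_factor_int p0 pE.
have [g0 h0] : g != 0 /\ h != 0 by apply/andP; rewrite -negb_or -mulf_eq0 -pgh.
exists g, h; have size_gh := size_mul g0 h0; rewrite -pgh size_p in size_gh.
have size_F : (msize (map_mpoly intr F : {mpoly rat[2]}) <= n.+1)%N.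
  rewrite msizeE; apply/bigmax_leqP_seq => m + _.
  by rewrite (perm_mem (msupp_map_mpoly F intr_injQ)) => /(dhomogP _ _ _ F_homog) ->.
rewrite FGH msizeM // in size_F.
have := size_line_poly G P' Q'; have := size_line_poly H P' Q'.
rewrite -size_g -size_h; move: size_F size_G size_H size_gh.
move: (msize G) (msize H) (size g) (size h) => sG sH sg sh *.
by split=> //; lia.
Qed.

Definition linear_factorization (R : rcfType) n (F : binpoly int)
    (l : 'I_n -> R[i] * R[i]) : Prop :=
  map_mpoly intr F
  = \prod_(i < n) ((l i).1 *: 'X_ord0 - (l i).2 *: 'X_ord_max) :> binpoly R[i].

Section ProductOfLinearForms.
Variables (R : rcfType) (n : nat) (F : binpoly int) (l : 'I_n -> R[i] * R[i]).
Hypothesis F_prod : linear_factorization F l.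
Local Notation N := (normc_absv R).

Lemma linear_factor_neq0 : F != 0 -> forall i, l i != 0.
Proof.
move=> + i; apply: contra_neq => l0; apply/mpolyP => w; rewrite mcoeff0.
apply: (@intr_inj R[i]); rewrite -mcoeff_map_mpoly F_prod (bigD1 i) //= l0.
by rewrite !scale0r subrr mul0r mcoeff0.
Qed.

Lemma map_line_poly_prod P Q : map_poly intr (line_poly F P Q)
  = \prod_i ((lform (l i) P)%:P + lform (l i) Q *: 'X).
Proof. by rewrite map_line_poly F_prod line_poly_prod. Qed.

Lemma bin_eval_prod P : (bin_eval F P.1 P.2)%:~R = \prod_i lform (l i) P.
Proof.
have -> : bin_eval F P.1 P.2 = (line_poly F P 0).[0].
  by rewrite horner_line_poly !mulr0 !addr0.
rewrite -horner_map /= map_line_poly_prod horner_prod.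
by apply: eq_bigr => i _; rewrite !hornerE.
Qed.

Lemma form_abs_bin_eval P : form_abs N l P = `|bin_eval F P.1 P.2|%:~R.
Proof. by rewrite -(absv_int N) bin_eval_prod absv_prod. Qed.

(* With Z' completing Z to a basis, W = u Z + v Z' for v = det2 Z W, so F W is
   congruent to F (u Z) = 0 modulo v. *)
Lemma det2_dvd_bin_eval i Z W : primitive Z -> lform (l i) Z = 0 ->
  (det2 Z W %| bin_eval F W.1 W.2)%Z.
Proof.
move=> primZ lZ; have [Z' ZZ'] := primitive_complete primZ.
set u := det2 W Z'; set v := det2 Z W; pose q := line_poly F (Z *~ u) Z'.
have q0 : q.[0] = 0.
  rewrite horner_line_poly !mulr0 !addr0; apply/eqP; rewrite -(intr_eq0 R[i]).
  rewrite (bin_eval_prod (Z *~ u)) (bigD1 i) //= lformMz lZ mul0r mul0r //.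
have -> : bin_eval F W.1 W.2 = q.[v].
  rewrite horner_line_poly {1 2}(det2_decomp W ZZ') -/u -/v /=.
  by rewrite !(raddfMz fst) !(raddfMz snd) !mulrzz.
have /factor_theorem[q' ->] : root q 0 by apply/rootP.
by rewrite hornerM !hornerE dvdz_mull.
Qed.

Lemma det2_le_form_abs i Z W : primitive Z -> lform (l i) Z = 0 ->
  form_abs N l W != 0 -> `|det2 Z W|%:~R <= form_abs N l W.
Proof.
move=> primZ lZ; rewrite form_abs_bin_eval intr_eq0 normr_eq0 ler_int => FW.
have := det2_dvd_bin_eval W primZ lZ; rewrite dvdzE => /dvdn_leq le_abs.
by rewrite -!abszE lez_nat le_abs // absz_gt0.
Qed.

Lemma discrete_of_int_factor W E (A : {set 'I_n}) (f : {poly int}) (d : R[i]) :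
  det2 W E = 1 -> (forall i, lform (l i) W != 0) ->
  map_poly intr f
    = d *: \prod_(i in A) ('X - (- (lform (l i) E / lform (l i) W))%:P) ->
  discrete N l A (N d / \prod_(i in A) N (lform (l i) W)).
Proof.
move=> WE lW_neq0 fE P.
have [z zE] := homogenize_prod (det2 P E) (det2 W P) fE.
suff -> : N d / \prod_(i in A) N (lform (l i) W) * \prod_(i in A) N (lform (l i) P)
    = `|z|%:~R.
  by rewrite intr_eq0 normr_eq0; apply: ler1_norm_intr.
rewrite -(absv_int N) zE absvM absv_prod -mulrA; congr (_ * _).
rewrite -prodfV -big_split /=; apply: eq_bigr => i _.
have -> : lform (l i) P = lform (l i) W *
    ((det2 P E)%:~R - - (lform (l i) E / lform (l i) W) * (det2 W P)%:~R).
  rewrite {1}(det2_decomp P WE) raddfD /= !lformMz; field; exact: lW_neq0.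
by rewrite absvM mulKf // gt_eqF // absv_gt0.
Qed.

Hypotheses (F_homog : F \is n.-homog) (F_red : reducible F).
Hypothesis l_neq0 : forall i, l i != 0.

Lemma exists_discrete_split : exists (A : {set 'I_n}) (c : R),
  [/\ 0 < c, discrete N l A c, discrete N l (~: A) c^-1, A != set0 & ~: A != set0].
Proof.
pose E : (int * int) * (int * int) := ((1, 0), (0, 1)).
have [k _ lW_neq0] := @exists_nonvanishing_shear _ _ N E erefl n l l_neq0.
set W := E.1 + E.2 *~ k in lW_neq0.
have WE : det2 W E.2 = 1 by apply: det2_shear.
pose th i := - (lform (l i) E.2 / lform (l i) W); pose C := \prod_i lform (l i) W.
have C_neq0 : C != 0 by apply/prodf_neq0 => i _; apply: lW_neq0.
have pE : map_poly intr (line_poly F E.2 W) = C *: \prod_i ('X - (th i)%:P).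
  rewrite map_line_poly_prod -mul_polyC rmorph_prod -big_split /=.
  apply: eq_bigr => i _; rewrite mulrBr -polyCM /th mulrN [_ * (_ / _)]mulrC divfK //.
  by rewrite polyCN opprK addrC mul_polyC.
have size_intr (f : {poly int}) : size (map_poly intr f : {poly R[i]}) = size f.
  by apply: size_map_inj_poly; [exact: intr_inj | rewrite rmorph0].
have size_p : size (line_poly F E.2 W) = n.+1.
  by rewrite -size_intr pE size_scale // -big_enum size_prod_XsubC -cardE card_ord.
have [g [h [pgh size_g size_h]]] := line_poly_reducible F_homog F_red size_p.
have [|A [d [d_neq0 gE hE]]] := @prod_XsubC_factor _ _ th (map_poly intr g)
  (map_poly intr h) C C_neq0; first by rewrite -rmorphM -pgh.
have nonempty (B : {set 'I_n}) (f : {poly int}) (e : R[i]) : (1 < size f)%N ->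
    map_poly intr f = e *: \prod_(i in B) ('X - (th i)%:P) -> B != set0.
  move=> + fE; apply: contraTneq => B0; rewrite -leqNgt -size_intr fE B0 big_set0.
  by rewrite (leq_trans (size_scale_leq _ _)) ?size_poly1.
have N_gt0 (B : {set 'I_n}) : 0 < \prod_(i in B) N (lform (l i) W).
  by apply: prodr_gt0 => i _; rewrite absv_gt0.
exists A, (N d / \prod_(i in A) N (lform (l i) W)); split.
- by rewrite divr_gt0 ?absv_gt0.
- exact: discrete_of_int_factor WE lW_neq0 gE.
- have -> : (N d / \prod_(i in A) N (lform (l i) W))^-1
      = N (C / d) / \prod_(i in ~: A) N (lform (l i) W).
    apply/eqP; rewrite invf_div eqr_div ?lt0r_neq0 ?absv_gt0 //.
    by rewrite -absvM divfK // absv_prod -prod_setC.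
  exact: discrete_of_int_factor WE lW_neq0 hE.
- exact: nonempty size_g gE.
exact: nonempty size_h hE.
Qed.

End ProductOfLinearForms.
End BinaryForms.

(** * Counting *)

Lemma exists_near_min (R : realType) (T : Type) (P : T -> Prop) (f : T -> R) (c : R) :
  0 < c -> (forall x, P x -> c <= f x) -> (exists x, P x) ->
  exists2 x, P x & forall y, P y -> f x <= 2 * f y.
Proof.
move=> c_gt0 c_le [x0 Px0].
pose E : set R := (fun r => exists2 x, P x & f x = r)%classic.
have E_lb : lbound E c by move=> _ [x Px <-]; apply: c_le.
have E_neq0 : nonempty E by exists (f x0), x0.
have inf_gt0 : 0 < inf E := lt_le_trans c_gt0 (lb_le_inf E_neq0 E_lb).
have [_ [x Px <-] fx_lt] := inf_adherent inf_gt0 (conj E_neq0 (ex_intro _ c E_lb)).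
exists x => // y Py; apply: le_trans (ltW fx_lt) _.
have : inf E <= f y by apply: (ge_inf (ex_intro _ c E_lb)); exists y.
by lra.
Qed.

Lemma at_most_of_families (R : realType) (T : pointedType) (A : set T) (B : R) :
  (forall k (f : 'I_k -> T), injective f -> (forall i, A (f i)) -> k%:R <= B) ->
  at_most A B.
Proof.
move=> family_le; have card_le k : (`I_k #<= A)%card -> k%:R <= B.
  move=> /pcard_leP /injfunPex[g gA g_inj].
  apply: (family_le k (fun i : 'I_k => g i)) => [i j gij|i].
    by apply/val_inj/g_inj => //; apply/mem_set/ltn_ord.
  by apply: gA => /=.
have [/finite_setP[k Ak]|A_infinite] := pselect (finite_set A).
  exists k; split; first by rewrite (card_le_eql Ak).
  by apply: card_le; rewrite (card_le_eqr Ak).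
have nat_le k : k%:R <= B.
  by apply/card_le/(card_le_trans (card_leT _))/infiniteP.
have := nat_le (Num.truncn B).+1.
by rewrite leNgt truncnS_gt // (nat_le 0%N).
Qed.

Lemma at_most_primitive_solutions (R : realType) (F : binpoly int) (m : int) (B : R) :
  (forall k (p : 'I_k -> int * int), (forall t, primitive_solution F m (p t)) ->
     (forall s t, s != t -> det2 (p s) (p t) != 0) -> k%:R <= B) ->
  at_most (primitive_solutions_up_to_sign F m) B.
Proof.
move=> family_le; apply: at_most_of_families => k f f_inj.
move=> /fin_all_exists2[p p_sol p_f]; apply: (family_le k p) => // s t.
apply: contra_neq => pst; apply: f_inj; rewrite -(p_f s) -(p_f t).
have [[prim_s _] [prim_t _]] := (p_sol s, p_sol t).
have [->//|->] := primitive_det2_eq0 prim_s prim_t pst.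
by rewrite /= !opprK -surjective_pairing classical_sets.setUC.
Qed.

Lemma double_succ_lt_exp72 (R : realFieldType) n :
  (3 <= n)%N -> 2 * n.+1%:R < (7 / 2) ^+ n :> R.
Proof.
move=> n3; have -> : (7 / 2 : R) ^+ n = 2 ^+ n * (7 / 4) ^+ n.
  by rewrite -exprMn; congr (_ ^+ _); field.
have succ_le : n.+1%:R <= 2 ^+ n :> R by rewrite -natrX ler_nat ltn_expl.
have exp_gt2 : 2 < (7 / 4) ^+ n :> R.
  apply: (@lt_le_trans _ _ ((7 / 4) ^+ 3)); first by lra.
  by apply: ler_weXn2l => //; lra.
have : 0 < n.+1%:R :> R by rewrite ltr0n.
nra.
Qed.

(* D stands for the absolute value of the discriminant and H for the height of F
   in some basis of Z^2. *)
Section ExponentBounds.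
Variables (R : realType) (n : nat) (m eps D : R).
Hypotheses (n_ge3 : (3 <= n)%N) (eps_gt0 : 0 < eps).
Hypothesis eps_lt : eps < 1 / (4 * (n%:R - 1)).
Hypotheses (m_ge1 : 1 <= m) (D_ge0 : 0 <= D).
Hypothesis m_le : m <= D `^ (1 / (4 * (n%:R - 1)) - eps)
           / ((7 / 2) `^ (n%:R / 2) * n%:R `^ (n%:R / (4 * (n%:R - 1)))).

Let r : R := 1 / (4 * (n%:R - 1)) - eps.
Let scaled_m : R := m * (7 / 2) `^ (n%:R / 2).
Let delta : R := 2 * (n%:R - 1) * eps.

Let n_ge1 : 1 <= n%:R :> R.
Proof. by rewrite ler1n; lia. Qed.

Let n_gt0 : 0 < n%:R :> R.
Proof. exact: lt_le_trans n_ge1. Qed.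

Let natr_pred : n.-1%:R = n%:R - 1 :> R.
Proof. by rewrite -subn1 natrB //; lia. Qed.

Let pred_gt0 : 0 < n%:R - 1 :> R.
Proof. by rewrite -natr_pred ltr0n; lia. Qed.

Let r_gt0 : 0 < r.
Proof. by rewrite subr_gt0. Qed.

Let delta_gt0 : 0 < delta.
Proof. by rewrite !mulr_gt0. Qed.

Let delta_lt : delta < 1 / 2.
Proof. by move: eps_lt; rewrite ltr_pdivlMr ?mulr_gt0 // /delta; lra. Qed.

Let expr72_ge1 k : 1 <= (7 / 2 : R) ^+ k.
Proof. by rewrite exprn_ege1 //; lra. Qed.

Let scaled_m_ge1 : 1 <= scaled_m.
Proof.
rewrite -[1]mulr1 ler_pM // -[leLHS](powRr0 (7 / 2)).
by apply: ler_powR; [lra | rewrite divr_ge0].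
Qed.

Let scaled_m_sqr : scaled_m ^+ 2 = (7 / 2) ^+ n * m ^+ 2.
Proof.
rewrite exprMn mulrC; congr (_ * _).
rewrite -powR_mulrn ?powR_ge0 // -powRrM divfK ?pnatr_eq0 // powR_mulrn //.
by lra.
Qed.

Lemma scaled_m_mul_le_powR : scaled_m * n%:R `^ (n%:R / (4 * (n%:R - 1))) <= D `^ r.
Proof. by rewrite -mulrA -ler_pdivlMr // mulr_gt0 ?powR_gt0 //; lra. Qed.

Lemma scaled_m_le_powR_discriminant : scaled_m <= D `^ r.
Proof.
apply: le_trans scaled_m_mul_le_powR; rewrite ler_peMr ?(le_trans ler01) //.
rewrite -[leLHS](powRr0 n%:R); apply: (ler_powR n_ge1).
by rewrite divr_ge0 // mulr_ge0 // ltW.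
Qed.

Lemma discriminant_ge1 : 1 <= D.
Proof.
have := le_trans scaled_m_ge1 scaled_m_le_powR_discriminant; apply: contraTT.
rewrite -!ltNge => D_lt1; apply: (@lt_le_trans _ _ (1 `^ r)); last by rewrite powR1.
by rewrite gt0_ltr_powR // nnegrE.
Qed.

Lemma scaled_m_expr_le_discriminant : scaled_m ^+ (4 * n.-1) <= D.
Proof.
have root_le : scaled_m <= D `^ (1 / (4 * (n%:R - 1))).
  apply: le_trans scaled_m_le_powR_discriminant _; apply: (ler_powR discriminant_ge1).
  by rewrite lerBlDr lerDl ltW.
have DE : (D `^ (1 / (4 * (n%:R - 1)))) ^+ (4 * n.-1) = D.
  rewrite -powR_mulrn ?powR_ge0 // -powRrM natrM natr_pred mul1r mulVf ?powRr1 //.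
  by rewrite gt_eqF ?mulr_gt0.
by rewrite -[leRHS]DE lerXn2r ?nnegrE ?powR_ge0 // (le_trans ler01).
Qed.

Lemma discriminant_ge : m ^+ 2 * 2 ^+ (n * n.-1) <= D.
Proof.
apply: le_trans scaled_m_expr_le_discriminant.
have -> : (4 * n.-1 = 2 * (n.-1 + n.-1))%N by rewrite addnn -mul2n mulnA.
rewrite [leRHS]exprM scaled_m_sqr [leRHS]exprD.
have m2_ge1 : 1 <= m ^+ 2 by rewrite exprn_ege1.
have ms2_ge1 : 1 <= (7 / 2) ^+ n * m ^+ 2 by rewrite -[leLHS]mulr1 ler_pM.
have ms2_ge0 := le_trans ler01 ms2_ge1; have m2_ge0 := le_trans ler01 m2_ge1.
apply: ler_pM; rewrite ?sqr_ge0 ?exprn_ge0 //.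
  apply: (@le_trans _ _ ((7 / 2) ^+ n * m ^+ 2)); first by rewrite ler_peMl.
  by rewrite -[leLHS]expr1; apply: ler_weXn2l; rewrite ?ltn_predRL ?(ltnW n_ge3).
rewrite exprM; apply: lerXn2r; rewrite ?nnegrE ?exprn_ge0 //.
apply: (@le_trans _ _ ((7 / 2) ^+ n)); last by rewrite ler_peMr // (le_trans ler01).
by rewrite lerXn2r ?nnegrE //; lra.
Qed.

Variable H : R.
Hypotheses (H_gt0 : 0 < H) (D_le : D <= n%:R ^+ n * H ^+ (n.-1).*2).

Lemma scaled_m_le_powR_height : scaled_m <= H `^ (1 / 2 - delta).
Proof.
have deltaE : 1 / 2 - delta = (n.-1).*2%:R * r.
  by rewrite -mul2n natrM natr_pred /delta /r; field; rewrite gt_eqF.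
rewrite -(ler_pM2r (powR_gt0 (n%:R / (4 * (n%:R - 1))) n_gt0)).
apply: le_trans scaled_m_mul_le_powR _; rewrite [leRHS]mulrC.
apply: (@le_trans _ _ ((n%:R ^+ n * H ^+ (n.-1).*2) `^ r)).
  by rewrite ge0_ler_powR ?nnegrE ?(ltW r_gt0) // (le_trans D_ge0).
rewrite powRM ?exprn_ge0 ?(ltW H_gt0) ?(ltW n_gt0) //.
rewrite deltaE powRrM powR_mulrn ?(ltW H_gt0) // ler_wpM2r ?powR_ge0 //.
rewrite -powR_mulrn ?(ltW n_gt0) // -powRrM; apply: (ler_powR n_ge1).
by rewrite ler_pM2l // /r -[leRHS]div1r lerBlDr lerDl ltW.
Qed.

Lemma height_ge1 : 1 <= H.
Proof.
have := le_trans scaled_m_ge1 scaled_m_le_powR_height; apply: contraTT.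
rewrite -!ltNge => H_lt1.
apply: (@lt_le_trans _ _ (1 `^ (1 / 2 - delta))); last by rewrite powR1.
by rewrite gt0_ltr_powR ?nnegrE ?(ltW H_gt0) //; have := delta_lt; lra.
Qed.

Lemma scaled_m_sqr_le_powR_height : (7 / 2) ^+ n * m ^+ 2 <= H `^ (1 - 2 * delta).
Proof.
have -> : 1 - 2 * delta = (1 / 2 - delta) * 2%:R by lra.
rewrite powRrM powR_mulrn ?powR_ge0 // -scaled_m_sqr.
by rewrite lerXn2r ?nnegrE ?powR_ge0 ?scaled_m_le_powR_height // (le_trans ler01).
Qed.

Lemma height_gt_double_succ : 2 * n.+1%:R < H.
Proof.
apply: lt_le_trans (double_succ_lt_exp72 _ n_ge3) _.
apply: (@le_trans _ _ ((7 / 2) ^+ n * m ^+ 2)).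
  by rewrite ler_peMr ?exprn_ege1 // (le_trans ler01).
apply: le_trans scaled_m_sqr_le_powR_height _; apply: ler1_powR height_ge1 _.
by have := delta_gt0; lra.
Qed.

Lemma powR_height_le_ratio : H `^ (2 * delta) <= H / (2 * m * (5 / 2) ^+ n).
Proof.
have exp_gt0 : 0 < (5 / 2 : R) ^+ n by rewrite exprn_gt0 //; lra.
have m_gt0 : 0 < m := lt_le_trans ltr01 m_ge1.
rewrite ler_pdivlMr ?mulr_gt0 //.
have HE : H `^ (1 - 2 * delta) * H `^ (2 * delta) = H.
  by rewrite -powRD ?subrK ?powRr1 ?(ltW H_gt0) // gt_eqF.
rewrite -[leRHS]HE mulrC ler_pM2r ?powR_gt0 //.
apply: le_trans scaled_m_sqr_le_powR_height.
have -> : (7 / 2 : R) ^+ n = (7 / 5) ^+ n * (5 / 2) ^+ n.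
  by rewrite -exprMn; congr (_ ^+ _); field.
have exp_ge2 : 2 <= (7 / 5 : R) ^+ n.
  apply: (@le_trans _ _ ((7 / 5) ^+ 3)); first by lra.
  by apply: ler_weXn2l => //; lra.
have -> : 2 * m * (5 / 2) ^+ n = 2 * (5 / 2) ^+ n * m by ring.
apply: ler_pM; rewrite ?mulr_ge0 ?(ltW exp_gt0) ?(ltW m_gt0) ?ler_pM2r //.
by rewrite expr2 ler_peMr // ltW.
Qed.

Lemma card_le_of_ratio_expr_le (c : nat) :
  (H / (2 * m * (5 / 2) ^+ n)) ^+ c <= (H ^+ 2) ^+ n -> c%:R <= n%:R / delta.
Proof.
move=> ratio_le; have H_gt1 : 1 < H.
  by have := height_gt_double_succ; rewrite -natr1; have := n_ge1; lra.
have powR_le : (H `^ (2 * delta)) ^+ c <= (H ^+ 2) ^+ n.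
  apply: le_trans ratio_le; rewrite lerXn2r ?nnegrE ?powR_ge0 ?powR_height_le_ratio //.
  exact: (le_trans (powR_ge0 _ _) powR_height_le_ratio).
rewrite ler_pdivlMr //; have lnH_gt0 : 0 < ln H by rewrite ln_gt0.
have : ln ((H `^ (2 * delta)) ^+ c) <= ln ((H ^+ 2) ^+ n).
  by rewrite ler_ln ?posrE ?exprn_gt0 ?powR_gt0.
rewrite -exprM !lnXn ?powR_gt0 // ln_powR.
rewrite -(mulr_natr (2 * delta * ln H)) -(mulr_natr (ln H)) natrM => ln_le.
have : 2 * ln H * (c%:R * delta) <= 2 * ln H * n%:R by lra.
by rewrite ler_pM2l ?mulr_gt0.
Qed.

End ExponentBounds.

Section SolutionCount.
Variables (R : realType) (n : nat) (F : binpoly int) (l : 'I_n -> R[i] * R[i]).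
Variables (m : int) (eps : R).
Local Notation N := (normc_absv R).
Hypotheses (n_ge3 : (3 <= n)%N) (F_form : binary_form n F) (F_red : reducible F).
Hypothesis F_prod : linear_factorization F l.
Hypotheses (eps_gt0 : 0 < eps) (eps_lt : eps < 1 / (4 * (n%:R - 1))) (m_gt0 : 0 < m).
Hypothesis m_le : m%:~R <= absdisc N l `^ (1 / (4 * (n%:R - 1)) - eps)
           / ((7 / 2) `^ (n%:R / 2) * n%:R `^ (n%:R / (4 * (n%:R - 1)))).

Let m_ge1 : 1 <= m%:~R :> R.
Proof. by rewrite -[1]/(1%:~R) ler_int -gtz0_ge1. Qed.

Let l_neq0 i : l i != 0.
Proof. by apply: linear_factor_neq0 F_prod _ i; case: F_form. Qed.

Let D_ge0 : 0 <= absdisc N l.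
Proof. exact: absdisc_ge0. Qed.

Let H_gt0 E : unimodular E -> 0 < height N E l.
Proof. by move=> E_unimod; apply: height_gt0. Qed.

Lemma exists_near_minimal_basis : exists2 E, unimodular E &
  forall E', unimodular E' -> height N E l <= 2 * height N E' l.
Proof.
apply: (exists_near_min ltr01) => [E E_unimod|]; last by exists ((1, 0), (0, 1)).
exact: (height_ge1 n_ge3 eps_gt0 eps_lt m_ge1 D_ge0 m_le (H_gt0 E_unimod)
  (absdisc_le_height l E_unimod)).
Qed.

Lemma card_primitive_solutions_le k (p : 'I_k -> int * int) :
  (forall t, primitive_solution F m (p t)) ->
  (forall s t, s != t -> det2 (p s) (p t) != 0) ->
  k%:R <= 2 * n%:R + n%:R / (2 * (n%:R - 1) * eps).
Proof.
move=> p_sol p_det2_neq0; have [E E_unimod E_min] := exists_near_minimal_basis.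
have D_le := absdisc_le_height l E_unimod.
have H_gt := height_gt_double_succ n_ge3 eps_gt0 eps_lt m_ge1 D_ge0 m_le
  (H_gt0 E_unimod) D_le.
have D_ge := discriminant_ge n_ge3 eps_gt0 eps_lt m_ge1 D_ge0 m_le.
have [A [c [c_gt0 discA discB A_neq0 AC_neq0]]] :=
  exists_discrete_split F_prod (proj2 F_form) F_red l_neq0.
have p_small t : form_abs N l (p t) <= m%:~R.
  by rewrite (form_abs_bin_eval F_prod) ler_int; case: (p_sol t).
have [s [k_le s_le]] := card_points_le E_unimod l_neq0 n_ge3 m_ge1 H_gt D_ge
  (det2_le_form_abs F_prod) c_gt0 discA discB A_neq0 AC_neq0
  (fun P P' PP' => E_min (P, P') PP') (fun t => proj1 (p_sol t)) p_small p_det2_neq0.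
have := card_le_of_ratio_expr_le n_ge3 eps_gt0 eps_lt m_ge1 D_ge0 m_le
  (H_gt0 E_unimod) D_le s_le.
have : k%:R <= (n + n + s)%:R :> R by rewrite ler_nat.
rewrite !natrD; lra.
Qed.

End SolutionCount.

Theorem theorem1p3 (R : realType) (n : nat) (F : mpoly.mpoly 2 int)
    (D : R[i]) (eps : R) (m : int) :
  (3 <= n)%N ->
  binary_form n F ->
  reducible F ->
  has_discriminant n F D ->
  (exists2 k : nat, max_num_linear_factors R F k & (3 <= k)%N)
    \/ product_of_two_rational_powers F ->
  0 < eps ->
  eps < 1 / (4 * (n%:R - 1)) ->
  0 < m ->
  m%:~R <= (ComplexField.Normc.normc D) `^ (1 / (4 * (n%:R - 1)) - eps)
           / ((7 / 2) `^ (n%:R / 2) * n%:R `^ (n%:R / (4 * (n%:R - 1)))) ->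
  at_most (primitive_solutions_up_to_sign F m)
    (2 * n%:R + n%:R / (2 * (n%:R - 1) * eps)).
Proof.
move=> n_ge3 F_form F_red [a [b [F_eq D_eq]]] _ eps_gt0 eps_lt m_gt0.
pose l i := (a i, b i); have F_prod : linear_factorization F l := F_eq.
have -> : ComplexField.Normc.normc D = absdisc (normc_absv R) l.
  by rewrite D_eq; apply: (absv_discriminant (normc_absv R) l).
move=> m_le; apply: at_most_primitive_solutions => k p p_sol p_det2_neq0.
exact: (card_primitive_solutions_le n_ge3 F_form F_red F_prod eps_gt0 eps_lt m_gt0
  m_le p_sol).
Qed.
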